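(* Let $\mathbf{k}$ be a unitary commutative ring and $X$ a set. Let $H=\mathbf{k}\mathfrak{X}_\infty$ be the free Rota-Baxter algebra of weight $\lambda=0$ on $X$ realized on Rota-Baxter bracketed words, with product $\diamond$, unit map $u:\mathbf{k}\to H$, $1_{\mathbf{k}}\mapsto 1$, coproduct $\Delta$ and counit $\varepsilon$ as defined in the context, and with the grading $H^{(n)}=\mathbf{k}\{w\in\mathfrak{X}_\infty\mid\deg(w)=n\}$, $n\ge0$, by total degree. Then $(H,\diamond,u,\Delta,\varepsilon)$ is a connected (graded) bialgebra, and hence a Hopf algebra.
   Context: All algebras are unitary over a unitary commutative ring $\mathbf{k}$. For a set $Y$, $M(Y)$ is the free monoid on $Y$ and $S(Y)=M(Y)\setminus\{1\}$ is the free semigroup; $\lfloor Y\rfloor=\{\lfloor y\rfloor\mid y\in Y\}$ is a set of symbols indexed by $Y$ and disjoint from $Y$. Bracketed words: put $\mathfrak{M}_0=M(X)$ and $\mathfrak{M}_{n+1}=M(X\cup\lfloor\mathfrak{M}_n\rfloor)$ for $n\ge0$. The natural inclusions $\mathfrak{M}_n\hookrightarrow\mathfrak{M}_{n+1}$ make these a direct system; its union is the monoid $\mathfrak{M}(X)=\varinjlim\mathfrak{M}_n$ (product: concatenation, identity $1$), which carries the map $w\mapsto\lfloor w\rfloor$. Rota-Baxter bracketed words (RBWs): for subsets $Y,Z$ of $\mathfrak{M}(X)$ let $$\Lambda(Y,Z)=\bigcup_{r\ge1}(Y\lfloor Z\rfloor)^r\cup\bigcup_{r\ge0}(Y\lfloor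 Z\rfloor)^rY\cup\bigcup_{r\ge1}(\lfloor Z\rfloor Y)^r\cup\bigcup_{r\ge0}(\lfloor Z\rfloor Y)^r\lfloor Z\rfloor\cup\{1\}.$$ Put $\mathfrak{X}_0=M(X)$, $\mathfrak{X}_n=\Lambda(S(X),\mathfrak{X}_{n-1})$ for $n\ge1$, and $\mathfrak{X}_\infty=\bigcup_{n\ge0}\mathfrak{X}_n$. The depth of $w\in\mathfrak{X}_\infty$ is $\mathrm{dep}(w)=\min\{n\mid w\in\mathfrak{X}_n\}$. Every RBW $w\ne1$ has a unique standard decomposition $w=w_1\cdots w_b$ (concatenation) with the $w_i$ alternately in $S(X)$ and in $\lfloor\mathfrak{X}_\infty\rfloor$; $b$ is the breadth of $w$. Product $\diamond$ (weight $\lambda=0$): it is the $\mathbf{k}$-bilinear product on $\mathbf{k}\mathfrak{X}_\infty$ (the free $\mathbf{k}$-module on $\mathfrak{X}_\infty$) with unit $1$ defined on basis elements by induction on $\mathrm{dep}(w)+\mathrm{dep}(w')$. If $w,w'$ both have breadth $1$, then $w\diamond w'=ww'$ (concatenation) if $w\in S(X)$ or $w'\in S(X)$, and $$\lfloor\bar w\rfloor\diamond\lfloor\bar w'\rfloor=\lfloor\lfloor\bar w\rfloor\diamond\bar w'\rfloor+\lfloor\bar w\diamond\lfloor\bar w'\rfloor\rfloor,$$ with $\lfloor\cdot\rfloor$ extended linearly. For $w,w'\neq1$ with standard decompositions $w=w_1\cdots w_m$ and $w'=w'_1\cdots w'_{m'}$, $w\diamond w'=w_1\cdots w_{m-1}(w_m\diamond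 w'_1)w'_2\cdots w'_{m'}$, with the other products being concatenation, extended linearly. Let $P:\mathbf{k}\mathfrak{X}_\infty\to\mathbf{k}\mathfrak{X}_\infty$ be the linear map with $P(w)=\lfloor w\rfloor$. It is known that $(\mathbf{k}\mathfrak{X}_\infty,\diamond,P)$ is the free (noncommutative, unital associative) Rota-Baxter algebra of weight $0$ on $X$, i.e. $P(u)P(v)=P(uP(v))+P(P(u)v)$. Alternating factorization: a sequence in $X\cup\lfloor\mathfrak{X}_\infty\rfloor$ is alternating if no two consecutive elements are both in $\lfloor\mathfrak{X}_\infty\rfloor$. Every $w\in\mathfrak{X}_\infty$ is uniquely $w=w_1\cdots w_m=w_1\diamond\cdots\diamond w_m$ with $w_1,\dots,w_m$ alternating ($m=0$ for $w=1$). Coproduct: with $H=\mathbf{k}\mathfrak{X}_\infty$ and $H\otimes H$ having the componentwise product, also denoted $\diamond$, the linear map $\Delta:H\to H\otimes H$ is defined on $\mathfrak{X}_\infty$ recursively by $\Delta(1)=1\otimes1$; $\Delta(x)=x\otimes1+1\otimes x$ for $x\in X$; $\Delta(\lfloor\bar w\rfloor)=\lfloor\bar w\rfloor\otimes1+(\mathrm{id}\otimes P)\Delta(\bar w)$ for $\bar w\in\mathfrak{X}_\infty$; and $\Delta(w)=\Delta(w_1)\diamond\cdots\diamond\Delta(w_m)$ if $w$ has alternating factorization $w_1\diamond\cdots\diamond w_m$. Counit: $\varepsilon:H\to\mathbf{k}$ is the linear map with $\varepsilon(1)=1_{\mathbf{k}}$ and $\varepsilon(w)=0$ for $w\in\mathfrak{X}_\infty\setminus\{1\}$.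 Total degree: for $w\in\mathfrak{X}_\infty$, $\deg(w)=\deg_P(w)+\deg_X(w)$, where $\deg_P(w)$ is the number of occurrences of the bracket operator $P=\lfloor\cdot\rfloor$ in $w$ and $\deg_X(w)$ is the number of occurrences (with multiplicity) of elements of $X$ in $w$; in particular $\deg(1)=0$. A $\mathbf{k}$-bialgebra is a quintuple $(H,\mu,u,\Delta,\varepsilon)$ where $(H,\mu,u)$ is a $\mathbf{k}$-algebra, $(H,\Delta,\varepsilon)$ is a $\mathbf{k}$-coalgebra, and $\Delta,\varepsilon$ are algebra homomorphisms. It is graded (by submodules $H^{(n)}$, $n\ge0$) if $H=\bigoplus_{n\ge0}H^{(n)}$, $H^{(p)}H^{(q)}\subseteq H^{(p+q)}$ and $\Delta(H^{(n)})\subseteq\bigoplus_{p+q=n}H^{(p)}\otimes H^{(q)}$; it is connected if in addition $H^{(0)}=\mathbf{k}$. A Hopf algebra is a bialgebra with an antipode, i.e. a linear endomorphism $S$ with $S\ast\mathrm{id}_H=\mathrm{id}_H\ast S=u\varepsilon$, where $f\ast g=\mu(f\otimes g)\Delta$. *)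

(* Defs.v *)
From HB Require Import structures.
From mathcomp Require Import all_boot all_order all_algebra.
From mathcomp Require Import finmap boolp classical_sets.
From mathcomp Require Import monalg.

Set Implicit Arguments.
Unset Strict Implicit.
Unset Printing Implicit Defensive.

Import GRing.Theory.
Local Open Scope ring_scope.

(* The free k-module on B.  This is {malg k[B]}; the scaling of monalg.v is
   restated because it is only declared there over nonzero rings. *)
Definition freemod (k : comPzRingType) (B : choiceType) : Type := {malg k[B]}.

Section FreeModule.
Context {k : comPzRingType} {B : choiceType}.

HB.instance Definition _ := GRing.Zmodule.on (freemod k B).

Definition fscale (c : k) (x : freemod k B) : freemod k B :=
  \sum_(b <- msupp x) << c * x@_b *g b >>.

Lemma fscaleE c x b : (fscale c x)@_b = c * x@_b.
Proof.
rewrite {2}[x]monalgE !raddf_sum mulr_sumr.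
by apply/eq_bigr=> /= i _; rewrite !mcoeffU mulrnAr.
Qed.

Lemma fscaleA c1 c2 x : fscale c1 (fscale c2 x) = fscale (c1 * c2) x.
Proof. by apply/malgP=> b; rewrite !fscaleE mulrA. Qed.

Lemma fscale1 : left_id 1 fscale.
Proof. by move=> x; apply/malgP=> b; rewrite !fscaleE mul1r. Qed.

Lemma fscaleDr : right_distributive fscale +%R.
Proof.
by move=> c x y; apply/malgP=> b; rewrite fscaleE !mcoeffD !fscaleE mulrDr.
Qed.

Lemma fscaleDl x : {morph fscale^~ x : c1 c2 / c1 + c2}.
Proof.
by move=> c1 c2; apply/malgP=> b; rewrite !(mcoeffD, fscaleE) mulrDl.
Qed.

HB.instance Definition _ := GRing.Zmodule_isLmodule.Build k (freemod k B)
  fscaleA fscale1 fscaleDr fscaleDl.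

Lemma fcoeffZ (c : k) (x : freemod k B) b : (c *: x)@_b = c * x@_b.
Proof. exact: fscaleE. Qed.

Definition basis (b : B) : freemod k B := << (1 : k) *g b >>.

Lemma freemodE (x : freemod k B) : x = \sum_(b <- msupp x) x@_b *: basis b.
Proof.
rewrite {1}[x]monalgE; apply: eq_bigr => b _; apply/malgP => b'.
by rewrite fcoeffZ !mcoeffU mulrnAr mulr1.
Qed.

Section LinearExtension.
Context {V : lmodType k} (f : B -> V).

Definition linext (x : freemod k B) : V := \sum_(b <- msupp x) x@_b *: f b.

Lemma linextEw (d : {fset B}) x : (msupp x `<=` d)%fset ->
  linext x = \sum_(b <- d) x@_b *: f b.
Proof.
move=> le_xd; rewrite /linext [RHS](big_fsetID _ (mem (msupp x))) /=.
rewrite [X in _ = _ + X]big1_fset ?addr0 => [|b /imfsetP[/= c]]; last first.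
  by rewrite inE => /andP[_ /mcoeff_outdom c0] -> _; rewrite c0 scale0r.
apply: eq_fbigl => b; rewrite !inE /=; apply/idP/andP => [bx|[]//].
by split=> //; apply: (fsubsetP le_xd).
Qed.

Lemma linext_is_linear : linear linext.
Proof.
move=> c x y.
have le1 : (msupp (c *: x + y) `<=` msupp x `|` msupp y)%fset.
  apply/fsubsetP => b; rewrite inE -!mcoeff_neq0 mcoeffD fcoeffZ.
  apply: contraR; rewrite negb_or !negbK => /andP[/eqP-> /eqP->].
  by rewrite mulr0 addr0.
rewrite (linextEw le1) (linextEw (fsubsetUl (msupp x) (msupp y))).
rewrite (linextEw (fsubsetUr (msupp x) (msupp y))) scaler_sumr -big_split /=.
by apply: eq_bigr => b _; rewrite mcoeffD fcoeffZ scalerDl scalerA.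
Qed.

HB.instance Definition _ :=
  GRing.isLinear.Build k (freemod k B) V *:%R linext linext_is_linear.

Lemma linext_basis b : linext (basis b) = f b.
Proof.
by rewrite (linextEw msuppU_le) big_seq_fset1 mcoeffUU scale1r.
Qed.

Lemma linext_uniq (g : freemod k B -> V) : linear g ->
  (forall b, g (basis b) = f b) -> g =1 linext.
Proof.
move=> lin_g gE x.
pose gL := GRing.isLinear.Build k (freemod k B) V *:%R g lin_g.
pose G : {linear freemod k B -> V} := HB.pack g gL.
rewrite {1}[x]freemodE -[g]/(G : _ -> _) linear_sum; apply: eq_bigr => b _.
by rewrite linearZ /= gE.
Qed.

End LinearExtension.
End FreeModule.

Definition bilin (k : comPzRingType) (U V W : lmodType k) (f : U -> V -> W) :=
  (forall x, linear (f x)) /\ (forall y, linear (f^~ y)).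

Definition bilext (k : comPzRingType) (A B : choiceType) (V : lmodType k)
    (f : A -> B -> V) (x : freemod k A) (y : freemod k B) : V :=
  linext (fun a => linext (f a) y) x.

Lemma bilext_bilin (k : comPzRingType) (A B : choiceType) (V : lmodType k)
  (f : A -> B -> V) : bilin (bilext f).
Proof.
split=> [x c y1 y2|y]; last exact: linext_is_linear.
rewrite /bilext.
have E y : linext (fun a => linext (f a) y) x
         = \sum_(a <- msupp x) x@_a *: linext (f a) y by [].
rewrite !E scaler_sumr -big_split /=; apply: eq_bigr => a _.
by rewrite linext_is_linear scalerDr !scalerA mulrC.
Qed.

Lemma bilext_basis (k : comPzRingType) (A B : choiceType) (V : lmodType k)
  (f : A -> B -> V) a b : bilext f (basis a) (basis b) = f a b.
Proof. by rewrite /bilext !linext_basis. Qed.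

(* The tensor product of the free modules on A and B is modelled by the free
   module on A * B; tens_universal states its universal property. *)
Section Tensor.
Context {k : comPzRingType}.
Implicit Types A B C D : choiceType.

Definition tens {A B} : freemod k A -> freemod k B -> freemod k (A * B)%type :=
  bilext (fun a b => basis (a, b)).

Lemma tens_universal A B (V : lmodType k) (f : freemod k A -> freemod k B -> V) :
  bilin f ->
  exists g : freemod k (A * B)%type -> V,
    [/\ linear g, forall x y, g (tens x y) = f x y &
        forall h, linear h -> (forall x y, h (tens x y) = f x y) -> h =1 g].
Proof.
move=> [fr fl]; pose g := linext (fun p : A * B => f (basis p.1) (basis p.2)).
have gU a b : g (tens (basis a) (basis b)) = f (basis a) (basis b).
  by rewrite /g /tens bilext_basis linext_basis.
exists g; split=> [|x y|h lin_h hE]; first exact: linext_is_linear.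
- have [tr tl] := bilext_bilin (fun (a : A) (b : B) => @basis k _ (a, b)).
  have lin1 (z : freemod k A) : linear (fun w => g (tens z w)).
    by move=> c w1 w2; rewrite /tens tr /g linext_is_linear.
  have lin2 (w : freemod k B) : linear (fun z => g (tens z w)).
    by move=> c z1 z2; rewrite /tens tl /g linext_is_linear.
  rewrite (linext_uniq (f := fun a => f (basis a) y) (fl y)) //.
  apply: (linext_uniq (lin2 y)) => a.
  rewrite (linext_uniq (f := fun b => f (basis a) (basis b)) (fr (basis a))) //.
  by apply: (linext_uniq (lin1 _)) => b; apply: gU.
- apply: (linext_uniq lin_h) => -[a b] /=.
  by rewrite -hE /tens bilext_basis.
Qed.

(* f (x) g, for linear f and g *)
Definition tensmap {A B C D} (f : freemod k A -> freemod k C)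
    (g : freemod k B -> freemod k D) :
    freemod k (A * B)%type -> freemod k (C * D)%type :=
  linext (fun p => tens (f (basis p.1)) (g (basis p.2))).

Definition tens_assoc {A B C} :
    freemod k ((A * B) * C)%type -> freemod k (A * (B * C))%type :=
  linext (fun p => basis (p.1.1, (p.1.2, p.2))).

(* (x (x) y) (x' (x) y') = (x x') (x) (y y') *)
Definition tens_mul {A B} (mA : freemod k A -> freemod k A -> freemod k A)
    (mB : freemod k B -> freemod k B -> freemod k B) :
    freemod k (A * B)%type -> freemod k (A * B)%type ->
    freemod k (A * B)%type :=
  bilext (fun p q => tens (mA (basis p.1) (basis q.1))
                          (mB (basis p.2) (basis q.2))).

(* Identifications k (x) H = H = H (x) k after applying eps on one side *)
Definition tens_counitl {A} (eps : freemod k A -> k) :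
    freemod k (A * A)%type -> freemod k A :=
  linext (fun p => eps (basis p.1) *: basis p.2).
Definition tens_counitr {A} (eps : freemod k A -> k) :
    freemod k (A * A)%type -> freemod k A :=
  linext (fun p => eps (basis p.2) *: basis p.1).

(* The map H (x) H -> H induced by a bilinear product *)
Definition tens_prod {A} (mul : freemod k A -> freemod k A -> freemod k A) :
    freemod k (A * A)%type -> freemod k A :=
  linext (fun p => mul (basis p.1) (basis p.2)).

(* Image of S (x) T in the tensor product of the ambient modules *)
Definition tens_sub {A B} (S : set (freemod k A)) (T : set (freemod k B)) :
    set (freemod k (A * B)%type) :=
  [set z | exists s : seq (freemod k A * freemod k B),
     (forall p, p \in s -> S p.1 /\ T p.2) /\ z = \sum_(p <- s) tens p.1 p.2].

End Tensor.

Section Bialgebra.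
Context (k : comPzRingType) (B : choiceType).
Let H : lmodType k := freemod k B.
Let HH : lmodType k := freemod k (B * B)%type.
Implicit Types (mul : H -> H -> H) (u : k -> H) (Delta : H -> HH) (eps : H -> k).

Record is_algebra mul u : Prop := IsAlgebra {
  alg_mul_bilin : bilin mul;
  alg_mulA : associative mul;
  alg_unit_linear : forall a b c : k, u (a * b + c) = a *: u b + u c;
  alg_mul1l : left_id (u 1) mul;
  alg_mulr1 : right_id (u 1) mul }.

Record is_coalgebra Delta eps : Prop := IsCoalgebra {
  coalg_Delta_linear : linear Delta;
  coalg_eps_linear : scalar eps;
  coalg_coassoc : forall x,
    tens_assoc (tensmap Delta id (Delta x)) = tensmap id Delta (Delta x);
  coalg_counitl : forall x, tens_counitl eps (Delta x) = x;
  coalg_counitr : forall x, tens_counitr eps (Delta x) = x }.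

Record is_bialgebra mul u Delta eps : Prop := IsBialgebra {
  bialg_algebra : is_algebra mul u;
  bialg_coalgebra : is_coalgebra Delta eps;
  bialg_Delta1 : Delta (u 1) = tens (u 1) (u 1);
  bialg_DeltaM : forall x y,
    Delta (mul x y) = tens_mul mul mul (Delta x) (Delta y);
  bialg_eps1 : eps (u 1) = 1;
  bialg_epsM : forall x y, eps (mul x y) = eps x * eps y }.

Record is_direct_sum (G : nat -> set H) : Prop := IsDirectSum {
  dsum_0 : forall n, G n 0;
  dsum_lin : forall n a x y, G n x -> G n y -> G n (a *: x + y);
  dsum_span : forall x, exists (N : nat) (h : nat -> H),
    (forall n, G n (h n)) /\ x = \sum_(n < N) h n;
  dsum_indep : forall (N : nat) (h : nat -> H), (forall n, G n (h n)) ->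
    \sum_(n < N) h n = 0 -> forall n, (n < N)%N -> h n = 0 }.

Record is_graded_bialgebra mul u Delta eps (G : nat -> set H) : Prop :=
  IsGradedBialgebra {
  graded_bialg : is_bialgebra mul u Delta eps;
  graded_dsum : is_direct_sum G;
  graded_mul : forall p q x y, G p x -> G q y -> G (p + q)%N (mul x y);
  graded_Delta : forall n x, G n x -> exists t : nat -> HH,
    (forall p, (p <= n)%N -> tens_sub (G p) (G (n - p)%N) (t p)) /\
    Delta x = \sum_(p < n.+1) t p }.

(* H^(0) = k means that u identifies k with H^(0). *)
Record is_connected_bialgebra mul u Delta eps (G : nat -> set H) : Prop :=
  IsConnectedBialgebra {
  connected_graded : is_graded_bialgebra mul u Delta eps G;
  connected_inj : injective u;
  connected_0 : G 0%N = range u }.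

Definition conv mul Delta (f g : H -> H) (x : H) : H :=
  tens_prod mul (tensmap f g (Delta x)).

Definition is_antipode mul u Delta eps (S : H -> H) : Prop :=
  [/\ linear S, forall x, conv mul Delta S id x = u (eps x)
    & forall x, conv mul Delta id S x = u (eps x)].

Definition is_hopf_algebra mul u Delta eps : Prop :=
  is_bialgebra mul u Delta eps /\ exists S, is_antipode mul u Delta eps S.

End Bialgebra.

(* Bracketed words: a word is a finite sequence of letters, a letter being a
   generator or a bracketed word.  The union of the tower M_n is the least
   solution of M = M(X u [M]), that is, this inductive type; the monoid law is
   concatenation of sequences, with unit [::]. *)
Inductive letter (X : Type) : Type :=
| Var of X
| Br of seq (letter X).
Arguments Br {X} _.

Notation word X := (seq (letter X)).

HB.instance Definition _ (X : Type) := gen_eqMixin (letter X).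
HB.instance Definition _ (X : Type) := gen_choiceMixin (letter X).

Section RBW.
Context {X : Type}.
Implicit Types (Y Z : set (word X)) (w : word X).
Local Open Scope classical_set_scope.

Definition MX : set (word X) := range (map (@Var X)).
Definition SX : set (word X) := MX `\ [::].

Definition catset Y Z : set (word X) := [set y ++ z | y in Y & z in Z].
Definition powset Y (r : nat) : set (word X) := iter r (catset Y) [set [::]].
Definition brset Z : set (word X) := [set [:: Br z] | z in Z].

Definition Lambda Y Z : set (word X) :=
  \bigcup_(r in [set r | (1 <= r)%N]) powset (catset Y (brset Z)) r `|`
  \bigcup_r catset (powset (catset Y (brset Z)) r) Y `|`
  \bigcup_(r in [set r | (1 <= r)%N]) powset (catset (brset Z) Y) r `|`
  \bigcup_r catset (powset (catset (brset Z) Y) r) (brset Z) `|`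
  [set [::]].

Fixpoint XX (n : nat) : set (word X) :=
  if n is n'.+1 then Lambda SX (XX n') else MX.

Definition XXoo : set (word X) := \bigcup_n XX n.

End RBW.

Definition rbw (X : Type) := {w : word X | w \in XXoo}.
HB.instance Definition _ (X : Type) := Choice.on (rbw X).

Section Words.
Context {X : Type}.
Implicit Types (w : word X).

Lemma rbw_ex (w : rbw X) : exists n, `[< XX n (val w) >].
Proof.
by have /set_mem[n _ wn] := valP w; exists n; apply/asboolP.
Qed.

Definition dep (w : rbw X) : nat := ex_minn (rbw_ex w).

Lemma XXoo_nil : [::] \in @XXoo X.
Proof. by rewrite inE; exists 0%N => //; exists [::]. Qed.

Lemma XXoo_br w : w \in XXoo -> [:: Br w] \in XXoo.
Proof.
rewrite !inE => -[n _ wn]; exists n.+1 => //=; left; right; exists 0%N => //.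
by exists [::] => //; exists [:: Br w] => //; exists w.
Qed.

Definition rbw1 : rbw X := exist _ [::] XXoo_nil.
Definition rbw_br (w : rbw X) : rbw X := exist _ [:: Br (val w)] (XXoo_br (valP w)).

(* The blocks of the standard decomposition: maximal runs of generators, and
   single brackets. *)
Fixpoint std_dec w : seq (word X) :=
  match w with
  | [::] => [::]
  | Br v :: w' => [:: Br v] :: std_dec w'
  | Var x :: w' =>
      if std_dec w' is (Var y :: s) :: r then (Var x :: Var y :: s) :: r
      else [:: Var x] :: std_dec w'
  end.

Fixpoint degP_letter (a : letter X) : nat :=
  if a is Br w then (sumn (map degP_letter w)).+1 else 0%N.
Definition degP w : nat := sumn (map degP_letter w).

Fixpoint degX_letter (a : letter X) : nat :=
  if a is Br w then sumn (map degX_letter w) else 1%N.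
Definition degX w : nat := sumn (map degX_letter w).

Definition deg (w : rbw X) : nat := (degP (val w) + degX (val w))%N.

End Words.

Section FreeRotaBaxter.
Context (k : comPzRingType) (X : Type).
Let H : lmodType k := freemod k (rbw X).
Let HH : lmodType k := freemod k (rbw X * rbw X)%type.

(* The basis element of an RBW; the value 0 on other words is not
   reached from RBWs. *)
Definition wbasis (w : word X) : H := if insub w is Some r then basis r else 0.

Definition unitH (a : k) : H := a *: basis rbw1.

Definition P : H -> H := linext (fun w => basis (rbw_br w)).

(* The product of basis elements, by recursion on a bound n for the sum of the
   depths (see diamond_rec_stable); the last block of w and the first block of w' are multiplied. When w
   or w' is 1, or one of these blocks lies in S(X), it is concatenation. *)
Fixpoint diamond_rec (n : nat) (w w' : word X) : H :=
  let s := std_dec w in let s' := std_dec w' in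
  match n, last [::] s, head [::] s' with
  | n'.+1, [:: Br u], [:: Br v] =>
      linext (fun z : rbw X =>
                wbasis (flatten (take (size s).-1 s) ++ val z
                        ++ flatten (behead s')))
        (P (diamond_rec n' [:: Br u] v) + P (diamond_rec n' u [:: Br v]))
  | _, _, _ => wbasis (w ++ w')
  end.

Definition diamond : H -> H -> H :=
  bilext (fun w w' : rbw X => diamond_rec (dep w + dep w') (val w) (val w')).

(* The letters of an RBW are its alternating factorization: an RBW has no two
   consecutive brackets (see XXooP). *)
Fixpoint Delta_letter (a : letter X) : HH :=
  match a with
  | Var x => tens (wbasis [:: Var x]) (basis rbw1)
             + tens (basis rbw1) (wbasis [:: Var x])
  | Br w => tens (wbasis [:: Br w]) (basis rbw1)
            + tensmap id P
                (foldr (fun b t => tens_mul diamond diamond (Delta_letter b) t)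
                       (tens (basis rbw1) (basis rbw1)) w)
  end.

Definition Delta_word (w : word X) : HH :=
  foldr (fun b t => tens_mul diamond diamond (Delta_letter b) t)
        (tens (basis rbw1) (basis rbw1)) w.

Definition Delta : H -> HH := linext (fun w : rbw X => Delta_word (val w)).

Definition eps (x : H) : k := x@_rbw1.

Definition Hdeg (n : nat) : set H :=
  [set x | forall w, w \in msupp x -> deg w = n].

End FreeRotaBaxter.

Section Characterization.
Context {X : Type}.
Implicit Types (w : word X) (a : letter X).

Definition isbr a := if a is Br _ then true else false.
Definition nobb : rel (letter X) := fun a b => ~~ (isbr a && isbr b).

(* Hereditarily no two consecutive brackets *)
Fixpoint wf_letter a : bool :=
  if a is Br w then all wf_letter w && sorted nobb w else true.
Definition wf w : bool := all wf_letter w && sorted nobb w.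

Fixpoint ht_letter a : nat :=
  if a is Br w then (foldr maxn 0 (map ht_letter w)).+1 else 0%N.
Definition ht w : nat := foldr maxn 0%N (map ht_letter w).

Lemma ht_cat w w' : ht (w ++ w') = maxn (ht w) (ht w').
Proof. by rewrite /ht; elim: w => [|a w IH] /=; rewrite ?max0n // IH maxnA. Qed.

Let lb w := isbr (last (Br [::]) w).
Let hb w := isbr (head (Br [::]) w).

Definition good (Z : set (word X)) w :=
  sorted nobb w /\ (forall p z s, w = p ++ Br z :: s -> Z z).

Lemma good_nil Z : good Z [::].
Proof. by split=> // -[]. Qed.

Lemma sorted_catb u v : sorted nobb u -> sorted nobb v ->
  [|| nilp u, nilp v, ~~ lb u | ~~ hb v] -> sorted nobb (u ++ v).
Proof.
case: u => [//|a u]; case: v => [|b v]; rewrite ?cats0 //=.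
rewrite /lb /hb /= cat_path => -> /= ->.
by rewrite andbT /nobb negb_and.
Qed.

Lemma split_br (p s u v : seq (letter X)) z : u ++ v = p ++ Br z :: s ->
  (exists s', u = p ++ Br z :: s') \/ (exists p', v = p' ++ Br z :: s).
Proof.
elim: u p => [|a u IH] [|b p] //=; first by right; exists [::].
- by right; exists (b :: p).
- by move=> [-> _]; left; exists u.
- move=> [-> /IH[[s' ->]|[p' ->]]]; first by left; exists s'.
  by right; exists p'.
Qed.

Lemma good_cat Z u v : good Z u -> good Z v ->
  [|| nilp u, nilp v, ~~ lb u | ~~ hb v] -> good Z (u ++ v).
Proof.
move=> [su gu] [sv gv] h; split; first exact: sorted_catb.
move=> p z s /split_br[[s' /gu]|[p' /gv]] //.
Qed.

Lemma SXP w : SX w <-> (w != [::]) && all (predC isbr) w.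
Proof.
split=> [[[s _ <-] /eqP ->]|/andP[/eqP w0 aw]].
  by elim: s.
split=> //; elim: w aw {w0} => [|[x|v] w IH] //= => [_|/IH[s _ <-]].
  by exists [::].
by exists (x :: s).
Qed.

Lemma SX_good Z w : SX w -> [/\ good Z w, ~~ lb w, ~~ hb w & ~~ nilp w].
Proof.
move=> /SXP/andP[w0 aw]; split.
- split=> [|p z s E]; last by move: aw; rewrite E all_cat /= andbF.
  case: w w0 aw => //= a w _; elim: w a => //= b w IH a /and3P[na nb aw].
  by rewrite IH /= ?nb // /nobb negb_and na.
- case/lastP: w w0 aw => // w a _; rewrite all_rcons => /andP[na _].
  by rewrite /lb last_rcons.
- by case: w w0 aw => //= a w _ /andP[].
- by case: w w0 aw.
Qed.

Lemma br_good Z w : brset Z w -> [/\ good Z w, lb w, hb w & ~~ nilp w].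
Proof.
move=> [z Zz <-]; split=> //; split=> // -[|a [|b p]] //= z' s.
by move=> [<-].
Qed.

Lemma Lambda_good Z w : Lambda SX Z w -> good Z w.
Proof.
have lbcat u v : ~~ nilp v -> lb (u ++ v) = lb v.
  by case: v => // a v _; rewrite /lb last_cat.
have hbcat u v : ~~ nilp u -> hb (u ++ v) = hb u by case: u.
have nilcat u v : nilp (u ++ v) = nilp u && nilp v by case: u.
have YB r v : powset (catset SX (brset Z)) r v -> good Z v /\ (nilp v || ~~ hb v).
  elim: r v => [|r IH] v /=; first by move=> ->; split=> //; apply: good_nil.
  move=> [_ [y /(SX_good Z)[gy ly hy ny] [b /br_good[gb lb' hb' nb] <-]] [t /IH[gt ht'] <-]].
  split; last by rewrite -catA hbcat ?hy ?orbT.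
  apply: good_cat => //; first by apply: good_cat; rewrite ?ly ?orbT.
  by case/orP: ht' => ->; rewrite ?orbT.
have BY r v : powset (catset (brset Z) SX) r v -> good Z v /\ (nilp v || ~~ lb v).
  elim: r v => [|r IH] v /=; first by move=> ->; split=> //; apply: good_nil.
  move=> [_ [b /br_good[gb lb' hb' nb] [y /(SX_good Z)[gy ly hy ny] <-]] [t /IH[gt ht'] <-]].
  split; last first.
    case tn: (nilp t) ht' => /= ht'; last by rewrite lbcat ?tn ?ht' ?orbT.
    by rewrite (nilP tn) cats0 lbcat ?ly ?orbT.
  apply: good_cat => //; first by apply: good_cat; rewrite ?hy ?orbT.
  by rewrite lbcat ?ly ?orbT.
case=> [[[[[r _ /YB[]//]|[r _ [u /YB[gu _] [v vY <-]]]]|[r _ /BY[]//]]|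
  [r _ [u /BY[gu lu] [v /br_good[gv _ _ _] <-]]]]|->]; last exact: good_nil.
- have [gv _ hv _] := SX_good Z vY.
  by apply: good_cat; rewrite ?hv ?orbT.
- by apply: good_cat => //; case/orP: lu => ->; rewrite ?orbT.
Qed.

Lemma catset_assoc (A B C : set (word X)) :
  catset (catset A B) C = catset A (catset B C).
Proof.
apply/seteqP; split=> w.
  move=> [_ [a Aa [b Bb <-]] [c Cc <-]]; exists a => //; exists (b ++ c).
    by exists b => //; exists c.
  by rewrite catA.
move=> [a Aa [_ [b Bb [c Cc <-]] <-]]; exists (a ++ b).
  by exists a => //; exists b.
by exists c; rewrite ?catA.
Qed.

Lemma catset1 (A : set (word X)) : catset A [set [::]]%classic = A.
Proof.
apply/seteqP; split=> w; first by move=> [a Aa [_ -> <-]]; rewrite cats0.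
by move=> Aw; exists w => //; exists [::] => //; rewrite cats0.
Qed.

Lemma powset_rot (A B : set (word X)) r :
  catset A (powset (catset B A) r) = catset (powset (catset A B) r) A.
Proof.
elim: r => [|r IH] /=.
  rewrite catset1; apply/seteqP; split=> w.
    by move=> Aw; exists [::] => //; exists w.
  by move=> [_ -> [a Aa <-]].
by rewrite [in RHS]catset_assoc -IH !catset_assoc.
Qed.

Lemma good_Lambda Z w : good Z w -> Lambda SX Z w.
Proof.
pose A1 (w : word X) := exists r, powset (catset SX (brset Z)) r.+1 w.
pose A2 (w : word X) := exists r, catset (powset (catset SX (brset Z)) r) SX w.
pose A3 (w : word X) := exists r, powset (catset (brset Z) SX) r.+1 w.
pose A4 (w : word X) := exists r, catset (powset (catset (brset Z) SX) r) (brset Z) w.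
suff h : good Z w -> w != [::] ->
    (if hb w then A3 w \/ A4 w else A1 w \/ A2 w).
  case: (eqVneq w [::]) => [-> _|w0 gw]; first by right.
  move: (h gw w0); case: ifP => _ [[r wr]|[r wr]].
  - by left; left; right; exists r.+1.
  - by left; right; exists r.
  - by left; left; left; left; exists r.+1.
  - by left; left; left; right; exists r.
elim: w => [//|a w IH] [sw gw] _.
have gw' : good Z w.
  split=> [|p z s E]; first by case: w sw {IH gw} => //= b w /andP[].
  by apply: (gw (a :: p) z s); rewrite E.
case: (eqVneq w [::]) sw gw => [->|w0] sw gw.
  case: a sw gw => [x|z] _ gw; rewrite /hb /=.
    right; exists 0%N, [::] => //; exists [:: Var x] => //.
    by apply/SXP.
  right; exists 0%N, [::] => //; exists [:: Br z] => //; exists z => //.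
  exact: (gw [::] z [::]).
have {IH} := IH gw' w0.
case: a sw gw => [x|z] sw gw; rewrite {2}/hb /=.
- have SXx : SX [:: Var x] by apply/SXP.
  have cSX t : SX t -> SX (Var x :: t) by move=> /SXP/andP[_ ta]; apply/SXP.
  case: ifP => _ [[r wr]|[r wr]].
  + right; exists r.+1; rewrite -powset_rot; exists [:: Var x] => //.
    by exists w.
  + left; exists r; rewrite /= catset_assoc.
    by exists [:: Var x] => //; exists w => //; rewrite powset_rot.
  + left; exists r; move: wr => [_ [y yS [b Bb <-]] [t tr <-]].
    exists (Var x :: y ++ b); last by exists t.
    by exists (Var x :: y); [exact: cSX|exists b].
  + right; exists r; move: wr; rewrite -!powset_rot => -[y yS [t tr <-]].
    by exists (Var x :: y); [exact: cSX|exists t].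
- have -> : hb w = false.
    by case: w sw w0 {gw gw'} => // b w /= /andP[]; rewrite /nobb /hb /=; case: isbr.
  have Bz : brset Z [:: Br z] by exists z => //; apply: (gw [::] z w).
  case=> -[r wr].
  + right; exists r.+1; rewrite -powset_rot.
    by exists [:: Br z] => //; exists w.
  + left; exists r; rewrite /= catset_assoc; exists [:: Br z] => //.
    by exists w => //; rewrite powset_rot.
Qed.

Lemma LambdaP Z w : Lambda SX Z w <-> good Z w.
Proof. by split; [apply: Lambda_good|apply: good_Lambda]. Qed.

Lemma MXP w : MX w <-> ht w = 0%N.
Proof.
split=> [[s _ <-]|]; first by elim: s => //= x s IH; rewrite /ht /= max0n.
elim: w => [|[x|v] w IH] /=; first by exists [::].
  by rewrite /ht /= max0n => /IH[s _ <-]; exists (x :: s).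
by rewrite /ht /= => /eqP; rewrite -leqn0 geq_max.
Qed.

Lemma XXP n w : XX n w <-> wf w /\ (ht w <= n)%N.
Proof.
elim: n w => [|n IH] w /=.
  rewrite MXP leqn0; split=> [h|[_ /eqP//]]; rewrite h; split=> //.
  move/MXP: h => [s _ <-]; rewrite /wf all_map; apply/andP; split.
    by elim: s.
  by case: s => //= x s; elim: s x => //= y s IH x; rewrite IH.
rewrite LambdaP; split=> [[sw gw]|[/andP[aw sw] hw]].
  rewrite /wf sw andbT; elim: w {sw} gw => [|a w IHw] //= gw.
  have [p z s E|-> hw] := IHw; first by apply: (gw (a :: p) z s); rewrite E.
  rewrite /ht /= geq_max -/(ht w) hw andbT.
  case: a gw => [//|z] gw.
  have /IH[wz hz] : XX n z by apply: (gw [::] z w).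
  by rewrite /= ltnS; split=> //; rewrite andbT.
split=> // p z s E; apply/IH.
move: aw hw; rewrite E all_cat ht_cat geq_max /= => /and3P[_ wz _] /andP[_].
by rewrite /ht /= geq_max ltnS => /andP[hz _]; split.
Qed.

Lemma XXooP w : (w \in XXoo) = wf w.
Proof.
apply/idP/idP => [/set_mem[n _ /XXP[]//]|ww].
by apply/mem_set; exists (ht w) => //; apply/XXP.
Qed.

Lemma depE (w : rbw X) : dep w = ht (val w).
Proof.
rewrite /dep; case: ex_minnP => n /asboolP/XXP[ww hw] hmin.
apply/eqP; rewrite eqn_leq hw andbT; apply: hmin.
by apply/asboolP/XXP.
Qed.

Lemma std_dec_flatten w : flatten (std_dec w) = w.
Proof.
elim: w => [//|[x|v] w IH] /=; last by rewrite IH.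
by case: (std_dec w) IH => [|[|[y|v] s] r] /= <-.
Qed.

End Characterization.

Section ProductEquations.
Context {k : comPzRingType} {X : Type}.
Implicit Types (w u v : word X).

Lemma wbasis_val (w : rbw X) : wbasis k (val w) = basis w.
Proof. by rewrite /wbasis valK. Qed.

Lemma eps_basis (w : rbw X) : eps (basis w : freemod k _) = (w == rbw1)%:R.
Proof. by rewrite /eps mcoeffU. Qed.

Let last_br w u : last [::] (std_dec w) = [:: Br u] ->
  exists p, w = rcons p (Br u).
Proof.
move=> E; have := std_dec_flatten w; case/lastP: (std_dec w) E => // s x.
rewrite last_rcons => -> <-; exists (flatten s).
by rewrite flatten_rcons cats1.
Qed.

Let head_br w u : head [::] (std_dec w) = [:: Br u] ->
  exists s, w = Br u :: s.
Proof.
move=> E; have := std_dec_flatten w; case: (std_dec w) E => // x s /= -> <-.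
by exists (flatten s).
Qed.

Lemma std_dec_rcons_br p u : std_dec (rcons p (Br u)) = rcons (std_dec p) [:: Br u].
Proof.
by elim: p => //= -[x|v] p -> //; case: (std_dec p) => [|[|[y|v] s] r].
Qed.

Lemma diamond_recS n w w' : diamond_rec k n.+1 w w' =
  match last [::] (std_dec w), head [::] (std_dec w') with
  | [:: Br u], [:: Br v] =>
      linext (fun z : rbw X =>
                wbasis k (flatten (take (size (std_dec w)).-1 (std_dec w))
                          ++ val z ++ flatten (behead (std_dec w'))))
        (P (diamond_rec k n [:: Br u] v) + P (diamond_rec k n u [:: Br v]))
  | _, _ => wbasis k (w ++ w')
  end.
Proof. by []. Qed.

(* Any bound that is at least the sum of the depths gives the same value *)
Lemma diamond_rec_stable n m w w' : (ht w + ht w' <= n)%N ->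
  (ht w + ht w' <= m)%N -> diamond_rec k n w w' = diamond_rec k m w w'.
Proof.
have ht_last (q z : word X) : (0 < ht (rcons q (Br z)))%N.
  by rewrite -cats1 ht_cat leq_max /ht /= maxn0 orbT.
have base j w1 w2 : (ht w1 + ht w2 <= 0)%N ->
    diamond_rec k j w1 w2 = wbasis k (w1 ++ w2).
  rewrite leqn0 addn_eq0 => /andP[/eqP hw _]; case: j => [//|j].
  rewrite diamond_recS; case Ew: (last _ _) => [//|[//|u] [|//]].
  by have [p wE] := last_br Ew; have := ht_last p u; rewrite -wE hw.
elim: n m w w' => [|n IH] m w w' hn hm; first by rewrite !base.
case: m hm => [|m] hm; first by rewrite !base.
rewrite !diamond_recS; case Ew: (last _ _) => [//|[//|u] [|//]].
case Ew': (head _ _) => [//|[//|v] [|//]].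
have [p wE] := last_br Ew; have [q wE'] := head_br Ew'.
have hu : (ht [:: Br u] <= ht w)%N by rewrite wE -cats1 ht_cat leq_maxr.
have hv : (ht [:: Br v] <= ht w')%N by rewrite wE' -cat1s ht_cat leq_maxl.
have hbr z : ht [:: Br z] = (ht z).+1 by rewrite /ht /= maxn0.
rewrite !hbr in hu hv.
have b1 N : (ht w + ht w' <= N.+1)%N -> (ht [:: Br u] + ht v <= N)%N.
  by move=> hN; rewrite hbr -ltnS -addnS (leq_trans _ hN) // leq_add.
have b2 N : (ht w + ht w' <= N.+1)%N -> (ht u + ht [:: Br v] <= N)%N.
  by move=> hN; rewrite hbr -ltnS -addSn (leq_trans _ hN) // leq_add.
rewrite (IH m [:: Br u] v (b1 _ hn) (b1 _ hm)).
by rewrite (IH m u [:: Br v] (b2 _ hn) (b2 _ hm)).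
Qed.

Lemma diamond_basis n (w w' : rbw X) : (dep w + dep w' <= n)%N ->
  diamond (basis w : freemod k _) (basis w') = diamond_rec k n (val w) (val w').
Proof.
move=> h; rewrite /diamond bilext_basis; apply: diamond_rec_stable;
  by rewrite -!depE.
Qed.

(* Concatenation, when it yields an RBW *)
Lemma diamond_cat (w w' z : rbw X) : val w ++ val w' = val z ->
  diamond (basis w : freemod k _) (basis w') = basis z.
Proof.
move=> zE; rewrite /diamond bilext_basis -wbasis_val -zE.
case: (_ + _)%N => [//|n]; rewrite diamond_recS.
case Ew: (last _ _) => [//|[//|u] [|//]].
case Ew': (head _ _) => [//|[//|v] [|//]].
have [p wE] := last_br Ew; have [q wE'] := head_br Ew'.
have := valP z; rewrite XXooP /wf -zE wE wE' -cats1 -catA => /andP[_] /=.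
case: (p) => [|a p'] /=; first by rewrite /nobb.
by rewrite cat_path => /and3P[_ _ /andP[]].
Qed.

Lemma P_basis (w : rbw X) : P (basis w : freemod k _) = basis (rbw_br w).
Proof. exact: linext_basis. Qed.

Let linear_comp (U V W : lmodType k) (f : U -> V) (g : V -> W) :
  linear f -> linear g -> linear (fun x => g (f x)).
Proof. by move=> lf lg c x y; rewrite lf lg. Qed.

Let linear_add (U V : lmodType k) (f g : U -> V) :
  linear f -> linear g -> linear (fun x => f x + g x).
Proof. by move=> lf lg c x y; rewrite lf lg addrACA scalerDr. Qed.

Lemma dep_br (w : rbw X) : dep (rbw_br w) = (dep w).+1.
Proof. by rewrite !depE /ht /= maxn0. Qed.

Let diamond_PP_basis (z t : rbw X) :
  diamond (P (basis z : freemod k _)) (P (basis t)) =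
  P (diamond (P (basis z)) (basis t)) + P (diamond (basis z) (P (basis t))).
Proof.
pose n := (dep z + dep t)%N.
have le0 : (dep (rbw_br z) + dep (rbw_br t) <= n.+2)%N.
  by rewrite !dep_br addSn addnS.
have le1 : (dep (rbw_br z) + dep t <= n.+1)%N by rewrite dep_br addSn.
have le2 : (dep z + dep (rbw_br t) <= n.+1)%N by rewrite dep_br addnS.
have E0 := diamond_basis le0; have E1 := diamond_basis le1.
have E2 := diamond_basis le2.
apply: etrans (congr2 (@diamond k X) (P_basis z) (P_basis t)) _.
apply: etrans E0 _; rewrite diamond_recS.
apply: etrans (_ : P (diamond_rec k n.+1 (val (rbw_br z)) (val t)) +
                   P (diamond_rec k n.+1 (val z) (val (rbw_br t))) = _).
  apply/esym/(linext_uniq (g := id)) => [|r] //.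
  by rewrite cats0; exact/esym/wbasis_val.
apply: congr2; apply: congr1; apply/esym.
  exact (etrans (congr1 (fun x => diamond x (basis t)) (P_basis z)) E1).
exact (etrans (congr1 (diamond (basis z)) (P_basis t)) E2).
Qed.

Lemma diamond_PP (x y : freemod k (rbw X)) :
  diamond (P x) (P y) = P (diamond (P x) y) + P (diamond x (P y)).
Proof.
have Pl : linear (@P k X) := linext_is_linear _.
have [dr dl] : bilin (@diamond k X) by apply: bilext_bilin.
have dRr z := linear_comp Pl (dr (P z)).
have dRl z := linear_comp Pl (dl (P z)).
have dSr z := linear_add (linear_comp (dr (P z)) Pl)
                         (linear_comp (linear_comp Pl (dr z)) Pl).
have dSl z := linear_add (linear_comp (linear_comp Pl (dl z)) Pl)
                         (linear_comp (dl (P z)) Pl).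
rewrite (linext_uniq (dRr x) (fun=> erefl _)).
apply/esym/(linext_uniq (dSr x)) => w' /=.
rewrite (linext_uniq (dRl (basis w')) (fun=> erefl _)).
apply: (linext_uniq (dSl (basis w'))) => z {x y dRr dRl dSr dSl} /=.
exact (esym (diamond_PP_basis z w')).
Qed.


End ProductEquations.

(* Main.v *)
Require Import Defs.
From HB Require Import structures.
From mathcomp Require Import all_boot all_order all_algebra.
From mathcomp Require Import finmap boolp classical_sets.
From mathcomp Require Import monalg zify.

Set Implicit Arguments.
Unset Strict Implicit.
Unset Printing Implicit Defensive.
Import GRing.Theory.
Local Open Scope ring_scope.

(** The proof rests on a description of the product by letters.  Two words can
    be concatenated unless a bracket meets a bracket, and in that case the
    product is computed at the junction by the Rota-Baxter rule
    P x * P y = P (P x * y + x * P y), the rest of both words staying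
    untouched.  Hence peeling the first letter off the left factor is always
    harmless ([rbmul_consA]), and every identity between products reduces to
    the meeting of two brackets.

    Associativity ([rbmulA]) is proved by induction on the total degree.  The
    reduction by letters leaves (P x * P y) * P z = P x * (P y * P z), where
    expanding both sides with the Rota-Baxter rule gives P applied to three
    instances of associativity of smaller degree.  The same induction shows
    that a linear map to an associative algebra is multiplicative as soon as
    it respects alternating factorizations and, for each pair of brackets,
    inherits multiplicativity from products of smaller degree
    ([rb_multiplicative]).  The counit qualifies because it kills the image of
    P.  The coproduct qualifies because of the cocycle rule
    Delta (P x) = P x ⊗ 1 + (id ⊗ P) (Delta x): multiplying two such
    expressions yields the same expression for the Rota-Baxter product, since
    id ⊗ P is itself a Rota-Baxter operator on the tensor square ([IP_RB]).

    Coassociativity and the counit identities compare algebra maps, so they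
    are checked on generators and shown to be stable under P, again by the
    cocycle rule.  Degrees add under the product, P raises the degree by one,
    and the only word of degree 0 is the empty one; this gives the grading and
    connectedness.

    Finally, in any connected bialgebra the map pi = id - u eps vanishes in
    degree 0, so its n-th convolution power vanishes in degrees below n
    ([pw_graded]).  The geometric series of (-1)^n times these powers is then
    locally finite and is a convolution inverse of id = u eps + pi, that is,
    an antipode ([connected_bialgebra_hopf]). *)

(** * Tensor operations on free modules *)

(** The operations enter only through their values on pure tensors.  They are
    locked so that unification does not try to tell two of them apart by
    unfolding both to sums over finite supports. *)
HB.lock Definition otimes (k : comPzRingType) (A B : choiceType) :
  freemod k A -> freemod k B -> freemod k (A * B)%type := tens.

HB.lock Definition tmap (k : comPzRingType) (A B C D : choiceType)
  (f : freemod k A -> freemod k C) (g : freemod k B -> freemod k D) :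
  freemod k (A * B)%type -> freemod k (C * D)%type := tensmap f g.

HB.lock Definition tassoc (k : comPzRingType) (A B C : choiceType) :
  freemod k ((A * B) * C)%type -> freemod k (A * (B * C))%type := tens_assoc.

HB.lock Definition tmul (k : comPzRingType) (A B : choiceType)
  (mA : freemod k A -> freemod k A -> freemod k A)
  (mB : freemod k B -> freemod k B -> freemod k B) :
  freemod k (A * B)%type -> freemod k (A * B)%type ->
  freemod k (A * B)%type := tens_mul mA mB.

HB.lock Definition tfold (k : comPzRingType) (A : choiceType)
  (mul : freemod k A -> freemod k A -> freemod k A) :
  freemod k (A * A)%type -> freemod k A := tens_prod mul.

HB.lock Definition tcounitl (k : comPzRingType) (A : choiceType)
  (e : freemod k A -> k) : freemod k (A * A)%type -> freemod k A :=
  tens_counitl e.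
HB.lock Definition tcounitr (k : comPzRingType) (A : choiceType)
  (e : freemod k A -> k) : freemod k (A * A)%type -> freemod k A :=
  tens_counitr e.

Local Notation "x ⊗ y" := (otimes x y) (at level 40, left associativity).

Section LinearAlgebra.
Context {k : comPzRingType}.
Implicit Types (A B C D : choiceType) (U V W : lmodType k).

Lemma lin0 U V (f : U -> V) : linear f -> f 0 = 0.
Proof. by move=> lf; have := lf (-1) 0 0; rewrite scaler0 addr0 scaleN1r addNr. Qed.

Lemma linD U V (f : U -> V) : linear f -> {morph f : x y / x + y}.
Proof. by move=> lf x y; have := lf 1 x y; rewrite !scale1r. Qed.

Lemma linZ U V (f : U -> V) : linear f -> forall c, {morph f : x / c *: x}.
Proof. by move=> lf c x; have := lf c x 0; rewrite !addr0 (lin0 lf) addr0. Qed.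

Lemma lin_sum U V (f : U -> V) : linear f ->
  forall (I : Type) (r : seq I) (Q : pred I) (F : I -> U),
  f (\sum_(i <- r | Q i) F i) = \sum_(i <- r | Q i) f (F i).
Proof.
by move=> lf I r Q F; apply: (big_morph f (linD lf) (lin0 lf)).
Qed.

Lemma lin_comp U V W (f : V -> W) (g : U -> V) :
  linear f -> linear g -> linear (fun x => f (g x)).
Proof. by move=> lf lg c x y; rewrite lg lf. Qed.

Lemma lin_add U V (f g : U -> V) :
  linear f -> linear g -> linear (fun x => f x + g x).
Proof. by move=> lf lg c x y; rewrite lf lg addrACA scalerDr. Qed.

Lemma lin_sub U V (f g : U -> V) :
  linear f -> linear g -> linear (fun x => f x - g x).
Proof. by move=> lf lg c x y; rewrite lf lg opprD addrACA scalerBr. Qed.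

Lemma lin_eq_basis B V (f g : freemod k B -> V) : linear f -> linear g ->
  (forall b, f (basis b) = g (basis b)) -> f =1 g.
Proof.
by move=> lf lg fg x; rewrite (linext_uniq lf fg) -(linext_uniq lg (fun=> erefl)).
Qed.

Lemma otimesE A B : @otimes k A B = tens. Proof. by rewrite otimes.unlock. Qed.
Lemma tmapE A B C D f g : @tmap k A B C D f g = tensmap f g.
Proof. by rewrite tmap.unlock. Qed.
Lemma tassocE A B C : @tassoc k A B C = tens_assoc.
Proof. by rewrite tassoc.unlock. Qed.
Lemma tmulE A B mA mB : @tmul k A B mA mB = tens_mul mA mB.
Proof. by rewrite tmul.unlock. Qed.
Lemma tfoldE A mul : @tfold k A mul = tens_prod mul.
Proof. by rewrite tfold.unlock. Qed.

Lemma otimes_linl A B (y : freemod k B) : linear (fun x : freemod k A => x ⊗ y).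
Proof. by rewrite otimesE; exact: (bilext_bilin _).2. Qed.
Lemma otimes_linr A B (x : freemod k A) : linear (@otimes k A B x).
Proof. by rewrite otimesE; exact: (bilext_bilin _).1. Qed.
Lemma tmap_lin A B C D f g : linear (@tmap k A B C D f g).
Proof. by rewrite tmapE; exact: linext_is_linear. Qed.
Lemma tassoc_lin A B C : linear (@tassoc k A B C).
Proof. by rewrite tassocE; exact: linext_is_linear. Qed.
Lemma tfold_lin A mul : linear (@tfold k A mul).
Proof. by rewrite tfoldE; exact: linext_is_linear. Qed.
Lemma tmul_bilin A B mA mB : bilin (@tmul k A B mA mB).
Proof. by rewrite tmulE; exact: bilext_bilin. Qed.

Lemma otimes_basis A B (a : A) (b : B) :
  basis a ⊗ basis b = basis (a, b) :> freemod k _.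
Proof. by rewrite otimesE; exact: bilext_basis. Qed.

Lemma lin_eq_otimes A B V (f g : freemod k (A * B)%type -> V) :
  linear f -> linear g ->
  (forall x y, f (x ⊗ y) = g (x ⊗ y)) -> f =1 g.
Proof.
by move=> lf lg fg; apply: lin_eq_basis => // -[a b]; rewrite -otimes_basis.
Qed.

Lemma bilin_eq_basis A B V (f g : freemod k A -> freemod k B -> V) :
  bilin f -> bilin g ->
  (forall a b, f (basis a) (basis b) = g (basis a) (basis b)) ->
  forall x y, f x y = g x y.
Proof.
move=> [fr fl] [gr gl] fg x y.
apply: (lin_eq_basis (fl y) (gl y)) => a.
exact: (lin_eq_basis (fr _) (gr _)).
Qed.

Lemma bilin_eq_otimes A B C D V
    (f g : freemod k (A * B)%type -> freemod k (C * D)%type -> V) :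
  bilin f -> bilin g ->
  (forall x y x' y', f (x ⊗ y) (x' ⊗ y') = g (x ⊗ y) (x' ⊗ y')) ->
  forall z z', f z z' = g z z'.
Proof.
move=> bf bg fg; apply: bilin_eq_basis bf bg _ => -[a b] [c d].
by rewrite -!otimes_basis.
Qed.

Lemma tmap_otimes A B C D (f : freemod k A -> freemod k C)
  (g : freemod k B -> freemod k D) x y : linear f -> linear g ->
  tmap f g (x ⊗ y) = f x ⊗ g y.
Proof.
move=> lf lg; move: x y; apply: bilin_eq_basis => [||a b].
- by split=> [x|y] c v w; rewrite ?otimes_linr ?otimes_linl tmap_lin.
- by split=> [x|y] c v w; rewrite ?lf ?lg ?otimes_linr ?otimes_linl.
- by rewrite otimes_basis tmapE otimesE /tensmap linext_basis.
Qed.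

Lemma tassoc_otimes A B C (x : freemod k A) (y : freemod k B) (z : freemod k C) :
  tassoc ((x ⊗ y) ⊗ z) = x ⊗ (y ⊗ z).
Proof.
apply: (lin_eq_basis (f := fun x => tassoc ((x ⊗ y) ⊗ z)) (g := fun x => x ⊗ (y ⊗ z))) x.
- by move=> c a b; rewrite !otimes_linl tassoc_lin.
- exact: otimes_linl.
move=> a; move: y z; apply: bilin_eq_basis.
- by split=> [y|z] c v w; rewrite ?otimes_linr ?otimes_linl tassoc_lin.
- by split=> [y|z] c v w; rewrite ?otimes_linl ?otimes_linr.
by move=> b c; rewrite !otimes_basis tassocE /tens_assoc linext_basis.
Qed.

Section TensMul.
Context {A B : choiceType} (mA : freemod k A -> freemod k A -> freemod k A)
  (mB : freemod k B -> freemod k B -> freemod k B).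
Hypotheses (bA : bilin mA) (bB : bilin mB).

Lemma tmul_linl y : linear (fun x => tmul mA mB x y).
Proof. exact: (tmul_bilin _ _).2. Qed.
Lemma tmul_linr x : linear (tmul mA mB x).
Proof. exact: (tmul_bilin _ _).1. Qed.

Lemma tmul_otimes x y x' y' :
  tmul mA mB (x ⊗ y) (x' ⊗ y') = mA x x' ⊗ mB y y'.
Proof.
have [Ar Al] := bA; have [Br Bl] := bB.
apply: (bilin_eq_basis (f := fun x y => tmul mA mB (x ⊗ y) _)
                 (g := fun x y => mA x x' ⊗ mB y y')) x y.
- by split=> [y|z] c v w; rewrite ?otimes_linr ?otimes_linl tmul_linl.
- by split=> [y|z] c v w; rewrite ?Bl ?Al ?otimes_linr ?otimes_linl.
move=> a b; move: x' y'; apply: bilin_eq_basis.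
- by split=> [y|z] c v w; rewrite ?otimes_linr ?otimes_linl tmul_linr.
- by split=> [y|z] c v w; rewrite ?Br ?Ar ?otimes_linr ?otimes_linl.
by move=> c d; rewrite !otimes_basis tmulE otimesE /tens_mul bilext_basis.
Qed.

Lemma tmulA : associative mA -> associative mB -> associative (tmul mA mB).
Proof.
move=> assA assB x y z.
apply: (lin_eq_otimes (f := fun x => tmul mA mB x (tmul mA mB y z))
  (g := fun x => tmul mA mB (tmul mA mB x y) z)) x => [||a b].
- exact: tmul_linl.
- by move=> c v w; rewrite !tmul_linl.
apply: (bilin_eq_otimes (f := fun y z => tmul mA mB (a ⊗ b) (tmul mA mB y z))
  (g := fun y z => tmul mA mB (tmul mA mB (a ⊗ b) y) z)).
- by split=> [x'|z'] c v w; rewrite ?tmul_linl ?tmul_linr.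
- by split=> [x'|z'] c v w; rewrite ?tmul_linr // ?tmul_linl.
by move=> x1 x2 y1 y2; rewrite !tmul_otimes assA assB.
Qed.

Lemma tmul1l eA eB : left_id eA mA -> left_id eB mB ->
  left_id (eA ⊗ eB) (tmul mA mB).
Proof.
move=> idA idB; apply: lin_eq_otimes => [||a b] //; first exact: tmul_linr.
by rewrite tmul_otimes idA idB.
Qed.

Lemma tmul1r eA eB : right_id eA mA -> right_id eB mB ->
  right_id (eA ⊗ eB) (tmul mA mB).
Proof.
move=> idA idB; apply: lin_eq_otimes => [||a b] //; first exact: tmul_linl.
by rewrite tmul_otimes idA idB.
Qed.
End TensMul.

Lemma tfold_otimes A (mul : freemod k A -> freemod k A -> freemod k A) x y :
  bilin mul -> tfold mul (x ⊗ y) = mul x y.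
Proof.
move=> bm; move: x y; apply: bilin_eq_basis bm _.
- by split=> [y|z] c v w; rewrite ?otimes_linr ?otimes_linl tfold_lin.
by move=> a b; rewrite otimes_basis tfoldE /tens_prod linext_basis.
Qed.

Lemma tcounitlE A e : @tcounitl k A e = tens_counitl e.
Proof. by rewrite tcounitl.unlock. Qed.
Lemma tcounitrE A e : @tcounitr k A e = tens_counitr e.
Proof. by rewrite tcounitr.unlock. Qed.
Lemma tcounitl_lin A e : linear (@tcounitl k A e).
Proof. by rewrite tcounitlE; exact: linext_is_linear. Qed.
Lemma tcounitr_lin A e : linear (@tcounitr k A e).
Proof. by rewrite tcounitrE; exact: linext_is_linear. Qed.

Lemma tcounitl_otimes A (e : freemod k A -> k) x y : scalar e ->
  tcounitl e (x ⊗ y) = e x *: y.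
Proof.
move=> le; move: x y; apply: bilin_eq_basis => [||a b].
- by split=> [y|z] c v w; rewrite ?otimes_linr ?otimes_linl tcounitl_lin.
- split=> [x|y] c v w; first by rewrite scalerDr !scalerA mulrC.
  by rewrite le scalerDl scalerA.
- by rewrite otimes_basis tcounitlE /tens_counitl linext_basis.
Qed.

Lemma tcounitr_otimes A (e : freemod k A -> k) x y : scalar e ->
  tcounitr e (x ⊗ y) = e y *: x.
Proof.
move=> le; move: x y; apply: bilin_eq_basis => [||a b].
- by split=> [y|z] c v w; rewrite ?otimes_linr ?otimes_linl tcounitr_lin.
- split=> [x|y] c v w; last by rewrite scalerDr !scalerA mulrC.
  by rewrite le scalerDl scalerA.
- by rewrite otimes_basis tcounitrE /tens_counitr linext_basis.
Qed.

(** * Homogeneous elements for a degree on the basis *)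
Section Homogeneous.
Context {B : choiceType} (d : B -> nat).
Implicit Types (x y : freemod k B).

Definition homog n x := forall b, b \in msupp x -> d b = n.

Lemma homog_coeff n x b : homog n x -> d b != n -> x@_b = 0.
Proof.
move=> hx nb; apply: mcoeff_outdom; apply: contra nb.
by move=> /hx ->.
Qed.

Lemma homogP n x : (forall b, d b != n -> x@_b = 0) -> homog n x.
Proof.
move=> hx b; rewrite -mcoeff_neq0; apply: contraNeq => /hx ->.
by rewrite eqxx.
Qed.

Lemma homog0 n : homog n 0.
Proof. by apply: homogP => b _; rewrite mcoeff0. Qed.

Lemma homog_lin n (c : k) x y : homog n x -> homog n y -> homog n (c *: x + y).
Proof.
move=> hx hy; apply: homogP => b nb.
by rewrite mcoeffD fcoeffZ (homog_coeff hx) // (homog_coeff hy) // mulr0 addr0.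
Qed.

Lemma homogD n x y : homog n x -> homog n y -> homog n (x + y).
Proof. by move=> hx hy; rewrite -[x]scale1r; apply: homog_lin. Qed.

Lemma homogZ n (c : k) x : homog n x -> homog n (c *: x).
Proof. by move=> hx; rewrite -[_ *: _]addr0; apply: homog_lin => //; apply: homog0. Qed.

Lemma homog_sum n (I : eqType) (r : seq I) (Q : pred I) (F : I -> freemod k B) :
  (forall i, i \in r -> Q i -> homog n (F i)) -> homog n (\sum_(i <- r | Q i) F i).
Proof.
move=> hF; rewrite big_seq_cond.
apply: (big_ind (homog n)); [exact: homog0|exact: homogD|].
by move=> i /andP[]; apply: hF.
Qed.

Lemma homog_basis b : homog (d b) (basis b).
Proof. by move=> c /(fsubsetP msuppU_le); rewrite inE => /eqP ->. Qed.

Lemma lin_eq_homog n V (f g : freemod k B -> V) x :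
  linear f -> linear g -> homog n x ->
  (forall b, d b = n -> f (basis b) = g (basis b)) -> f x = g x.
Proof.
move=> lf lg hx fg; rewrite [x]freemodE (lin_sum lf) (lin_sum lg).
by apply: eq_big_seq => b /hx db; rewrite (linZ lf) (linZ lg) fg.
Qed.

Definition hcomp n x : freemod k B :=
  \sum_(b <- msupp x | d b == n) x@_b *: basis b.

Lemma hcomp_homog n x : homog n (hcomp n x).
Proof.
apply: homog_sum => b _ /eqP <-; apply: homogZ; exact: homog_basis.
Qed.

Lemma sum_hcomp N x : (forall b, b \in msupp x -> d b < N)%N ->
  x = \sum_(n < N) hcomp n x.
Proof.
move=> hN; rewrite {1}[x]freemodE /hcomp.
rewrite (eq_bigr (fun n : 'I_N => \sum_(b <- msupp x)
   if d b == n then x@_b *: basis b else 0)); last by move=> n _; rewrite -big_mkcond.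
rewrite exchange_big /=; apply: eq_big_seq => b /hN lt_b.
by rewrite -big_mkcond (big_pred1 (Ordinal lt_b)) // => i; rewrite eq_sym.
Qed.

Lemma homog_direct_sum : is_direct_sum homog.
Proof.
split.
- exact: homog0.
- by move=> n c x y; apply: homog_lin.
- move=> x; exists (\max_(b <- msupp x) d b).+1, (hcomp^~ x); split=> [n|].
    exact: hcomp_homog.
  by apply: sum_hcomp => b xb; rewrite ltnS; apply: leq_bigmax_seq.
- move=> N h hh h0 n lt_n; apply/malgP => b; rewrite mcoeff0.
  have [db|nb] := eqVneq (d b) n; last by rewrite (homog_coeff (hh n)).
  have : (\sum_(n < N) h n)@_b = 0 by rewrite h0 mcoeff0.
  rewrite raddf_sum (bigD1 (Ordinal lt_n)) //= big1 ?addr0 // => i ni.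
  apply: homog_coeff (hh i) _; rewrite db.
  by apply: contra ni => /eqP ni; apply/eqP/val_inj.
Qed.
End Homogeneous.

Lemma homog_image B C (d : B -> nat) (e : C -> nat) n m
  (f : freemod k B -> freemod k C) x : linear f -> homog d n x ->
  (forall b, d b = n -> homog e m (f (basis b))) -> homog e m (f x).
Proof.
move=> lf hx hf; rewrite [x]freemodE (lin_sum lf).
apply: homog_sum => b /hx db _; rewrite (linZ lf); apply: homogZ; exact: hf.
Qed.

Lemma homog_otimes A B (d : A -> nat) (e : B -> nat) n m x y :
  homog d n x -> homog e m y ->
  homog (fun p => d p.1 + e p.2)%N (n + m)%N (x ⊗ y).
Proof.
move=> hx hy; apply: (homog_image (f := fun x => x ⊗ y)) hx _ => [|a da].
  exact: otimes_linl.
apply: (homog_image (f := fun y => basis a ⊗ y)) hy _ => [|b db].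
  exact: otimes_linr.
rewrite otimes_basis -da -db.
by have := @homog_basis (A * B)%type (fun p => d p.1 + e p.2)%N (a, b).
Qed.

(** Sorting the terms of [z] by the degree of their left component splits it
    into the pieces that the definition of a graded coproduct asks for. *)
Lemma homog_tens_sub A B (d : A -> nat) (e : B -> nat) n z :
  homog (fun p => d p.1 + e p.2)%N n z ->
  exists t : nat -> freemod k (A * B)%type,
    (forall p, (p <= n)%N -> tens_sub (homog d p) (homog e (n - p)%N) (t p)) /\
    z = \sum_(p < n.+1) t p.
Proof.
move=> hz; exists (fun p => hcomp (fun q => d q.1) p z); split=> [p le_p|].
  exists [seq (z@_q *: basis q.1, basis q.2) | q <- msupp z & d q.1 == p].
  split.
    move=> _ /mapP[q] + ->; rewrite mem_filter => /andP[/eqP dq /hz dz] /=.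
    split; first by apply: homogZ; rewrite -dq; apply: homog_basis.
    by rewrite -dz dq addKn; apply: homog_basis.
  rewrite big_map big_filter; apply: eq_bigr => -[a b] _ /=.
  by rewrite -otimesE (linZ (otimes_linl _)) otimes_basis.
by apply: sum_hcomp => q /hz <-; rewrite ltnS leq_addr.
Qed.

End LinearAlgebra.

(** * Well-formed words *)
Section WordCombinatorics.
Context {X : Type}.
Implicit Types (w u v p s : word X) (a : letter X).

(** The total degree makes sense on all bracketed words, so that subwords and
    concatenations can be measured before they are known to be well formed. *)
Definition wdeg w : nat := (degP w + degX w)%N.

Lemma wdeg_cat u v : wdeg (u ++ v) = (wdeg u + wdeg v)%N.
Proof. by rewrite /wdeg /degP /degX !map_cat !sumn_cat addnACA. Qed.

Lemma wdeg_cons a w : wdeg (a :: w) = (wdeg [:: a] + wdeg w)%N.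
Proof. by rewrite -cat1s wdeg_cat. Qed.

Lemma wdeg_br u : wdeg [:: Br u] = (wdeg u).+1.
Proof. by rewrite /wdeg /degP /degX /= !addn0. Qed.

Lemma wdeg_gt0 a : (0 < wdeg [:: a])%N.
Proof. by case: a => [x|u]; rewrite ?wdeg_br. Qed.

Lemma wdeg_eq0 w : wdeg w = 0%N -> w = [::].
Proof.
by case: w => // a w; rewrite wdeg_cons; have := wdeg_gt0 a; case: (wdeg _).
Qed.

Lemma wf_cons a w : wf (a :: w) -> wf [:: a] /\ wf w.
Proof.
rewrite /wf /= => /andP[/andP[-> ->]]; case: w => //= b w.
by move=> /andP[_ ->].
Qed.

(** The condition [wf (Br [::] :: s)] on the right is used throughout to say
    that [s] may follow a bracket: what the bracket contains does not matter,
    only that [s] does not start with one. *)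
Lemma wf_br u s : wf (Br u :: s) = wf u && wf (Br [::] :: s).
Proof. by rewrite /wf /= -!andbA; case: s. Qed.

Lemma wf_br1 u : wf [:: Br u] = wf u.
Proof. by rewrite wf_br andbT. Qed.

Lemma wf_brs s : wf (Br [::] :: s) -> wf s.
Proof. by case/wf_cons. Qed.

(** The dichotomy behind every case analysis below: two words concatenate to a
    word, or a bracket meets a bracket at the junction. *)
Lemma wf_cat u v : wf u -> wf v ->
  wf (u ++ v) \/
  exists p z t s, u = rcons p (Br z) /\ v = Br t :: s.
Proof.
have cat : [|| nilp u, nilp v, ~~ isbr (last (Br [::]) u)
    | ~~ isbr (head (Br [::]) v)] -> wf u -> wf v -> wf (u ++ v).
  move=> h /andP[au su] /andP[av sv].
  by rewrite /wf all_cat au av; apply: sorted_catb.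
case/lastP: u cat => [|p [x|z]] cat wu wv; first by left.
  by left; apply: cat; rewrite // last_rcons !orbT.
case: v cat wv => [|[x|t] s] cat wv; [by left; rewrite cats0| |].
  by left; apply: cat; rewrite // !orbT.
by right; exists p, z, t, s.
Qed.

Lemma wf_cons2 a b w : wf (a :: b :: w) = [&& wf [:: a], nobb a b & wf (b :: w)].
Proof.
rewrite /wf /=; case: (wf_letter a) => //=; case: (nobb a b); rewrite ?andbF //.
Qed.

Lemma wf_glue p u z v s : wf (rcons p (Br u)) -> wf (Br v :: s) -> wf z ->
  wf (p ++ Br z :: s).
Proof.
move=> + wvs wz; elim: p => [_|a p IH] /=.
  by move: wvs; rewrite wf_br => /andP[_ ws]; rewrite wf_br wz.
by case: p IH => [|b p] /= IH; rewrite !wf_cons2 /nobb /= => /and3P[-> -> /IH].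
Qed.

(** Every word is obtained from the generators by bracketing and by
    multiplying one letter onto a nonempty word.  Keeping the tail nonempty
    makes both factors smaller than the product, so that a property of algebra
    maps need only be checked on generators, brackets and products. *)
Lemma word_ind (Q : word X -> Prop) : Q [::] ->
  (forall x, Q [:: Var x]) ->
  (forall u, wf u -> Q u -> Q [:: Br u]) ->
  (forall a w, w <> [::] -> wf (a :: w) -> Q [:: a] -> Q w -> Q (a :: w)) ->
  forall w, wf w -> Q w.
Proof.
move=> Q0 QX QB QC w; have [n le_wn] := ubnP (wdeg w).
elim: n w le_wn => // n IH [|a w] // le_wn ww; rewrite ltnS in le_wn.
have [wa ww'] := wf_cons ww.
case: (pselect (w = [::])) => [w0|/[dup] w0 /(contra_not (@wdeg_eq0 w)) dw].
  rewrite w0; case: a wa le_wn {ww} => // u wu le_wn; apply: QB; rewrite wf_br1 in wu => //.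
  by apply: IH => //; apply: leq_trans le_wn; rewrite w0 wdeg_br.
rewrite wdeg_cons in le_wn.
apply: QC => //; apply: IH => //; apply: leq_trans le_wn.
  by rewrite -[X in (X < _)%N]addn0 ltn_add2l lt0n; apply/eqP.
by rewrite -[X in (X < _)%N]add0n ltn_add2r wdeg_gt0.
Qed.

End WordCombinatorics.

(** * The product by letters *)

(** As for the tensor operations, the product, the operator and the basis are
    used only through the equations proved in this part, hence locked. *)
HB.lock Definition wmon (k : comPzRingType) (X : Type) :
  word X -> freemod k (rbw X) := @wbasis k X.
HB.lock Definition rbmul (k : comPzRingType) (X : Type) :
  freemod k (rbw X) -> freemod k (rbw X) -> freemod k (rbw X) := @diamond k X.
HB.lock Definition rbP (k : comPzRingType) (X : Type) :
  freemod k (rbw X) -> freemod k (rbw X) := @P k X.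

Section ProductOnWords.
Context {k : comPzRingType} {X : Type}.
Implicit Types (w u v p s : word X) (a : letter X).
Local Notation H := (freemod k (rbw X)).

Local Notation wmon := (@wmon k X).
Local Notation rbmul := (@rbmul k X).
Local Notation rbP := (@rbP k X).
Local Notation "x ⋄ y" := (rbmul x y) (at level 40, left associativity).

Lemma wmonE : wmon = @wbasis k X. Proof. by rewrite wmon.unlock. Qed.
Lemma rbmulE : rbmul = @diamond k X. Proof. by rewrite rbmul.unlock. Qed.
Lemma rbPE : rbP = @P k X. Proof. by rewrite rbP.unlock. Qed.

Lemma rbP_lin : linear rbP.
Proof. by rewrite rbPE; exact: linext_is_linear. Qed.
Lemma rbmul_bilin : bilin rbmul.
Proof. by rewrite rbmulE; exact: bilext_bilin. Qed.
Lemma rbmul_linl y : linear (fun x : H => x ⋄ y).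
Proof. exact: rbmul_bilin.2. Qed.
Lemma rbmul_linr x : linear (rbmul x).
Proof. exact: rbmul_bilin.1. Qed.

Lemma rbw_of w : wf w -> exists z : rbw X, val z = w.
Proof. by rewrite -XXooP => ww; exists (exist _ w ww). Qed.

Lemma wf_val (z : rbw X) : wf (val z).
Proof. by rewrite -XXooP; apply: valP. Qed.

Lemma wmon_val (z : rbw X) : wmon (val z) = basis z.
Proof. by rewrite wmonE; apply: wbasis_val. Qed.

Lemma lin_eq_words (V : lmodType k) (f g : H -> V) : linear f -> linear g ->
  (forall w, wf w -> f (wmon w) = g (wmon w)) -> f =1 g.
Proof.
by move=> lf lg fg; apply: lin_eq_basis => // b; rewrite -wmon_val fg // wf_val.
Qed.

Lemma rbP_wmon u : wf u -> rbP (wmon u) = wmon [:: Br u].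
Proof. by case/rbw_of => z <-; rewrite !wmonE rbPE wbasis_val P_basis -wbasis_val. Qed.

Lemma rbmul_wcat u v : wf (u ++ v) -> wf u -> wf v -> wmon u ⋄ wmon v = wmon (u ++ v).
Proof.
move=> wuv /rbw_of[x xE] /rbw_of[y yE]; have [z zE] := rbw_of wuv.
rewrite wmonE rbmulE -zE -xE -yE !wbasis_val.
by apply: diamond_cat; rewrite xE yE.
Qed.

Lemma rbmul_wcons a w : wf (a :: w) -> wmon [:: a] ⋄ wmon w = wmon (a :: w).
Proof. by move=> /[dup] waw /wf_cons[wa ww]; rewrite -> rbmul_wcat. Qed.

(** The recursive definition of the product at a junction of two brackets.  The
    argument of [linext] is the element to which P is applied there. *)
Lemma rbmul_brackets p u v s : wf (rcons p (Br u)) -> wf (Br v :: s) ->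
  wmon (rcons p (Br u)) ⋄ wmon (Br v :: s) =
  linext (fun z : rbw X => wmon (p ++ Br (val z) :: s))
    (wmon [:: Br u] ⋄ wmon v + wmon u ⋄ wmon [:: Br v]).
Proof.
move=> wl wr.
have wu : wf u by move: wl; rewrite /wf all_rcons /= -andbA => /and3P[].
have [wv wv'] : wf v /\ wf [:: Br v].
  by move: wr; rewrite wf_br wf_br1 => /andP[].
rewrite wmonE rbmulE.
have [x xE] := rbw_of wl; have [y yE] := rbw_of wr.
have [zu uE] := rbw_of wu; have [zv vE] := rbw_of wv.
pose N := (dep x + dep y)%N.
have dx : (dep (rbw_br zu) <= dep x)%N.
  by rewrite !depE xE -cats1 ht_cat /= uE leq_maxr.
have dy : (dep (rbw_br zv) <= dep y)%N.
  by rewrite !depE yE -cat1s ht_cat /= vE leq_maxl.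
have E0 : diamond (wbasis k (rcons p (Br u))) (wbasis k (Br v :: s)) =
          diamond_rec k N.+1 (rcons p (Br u)) (Br v :: s).
  by rewrite -xE -yE !wbasis_val; apply: diamond_basis.
have E1 : diamond (wbasis k [:: Br u]) (wbasis k v) = diamond_rec k N [:: Br u] v.
  have -> : [:: Br u] = val (rbw_br zu) by rewrite /= uE.
  rewrite -vE !wbasis_val; apply: diamond_basis.
  by rewrite leq_add // (leq_trans _ dy) // dep_br.
have E2 : diamond (wbasis k u) (wbasis k [:: Br v]) = diamond_rec k N u [:: Br v].
  have -> : [:: Br v] = val (rbw_br zv) by rewrite /= vE.
  rewrite -uE !wbasis_val; apply: diamond_basis.
  by rewrite leq_add // (leq_trans _ dx) // dep_br.
rewrite E0 diamond_recS std_dec_rcons_br last_rcons /= size_rcons /=.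
rewrite -cats1 (take_size_cat _ (erefl _)) !std_dec_flatten -E1 -E2.
rewrite <- (linD (linext_is_linear _ : linear (@P k X))).
pose F (z : rbw X) := wbasis k (p ++ val z ++ s).
pose G (z : rbw X) := wbasis k (p ++ Br (val z) :: s).
have FG : (fun R => linext F (P R)) =1 linext G.
  apply: lin_eq_basis => [||b].
  - exact: (lin_comp (linext_is_linear F) (linext_is_linear _ : linear (@P k X))).
  - exact: linext_is_linear.
  - by rewrite P_basis !linext_basis.
exact: FG.
Qed.

Lemma rbmul_w1l (x : H) : wmon [::] ⋄ x = x.
Proof.
apply: (lin_eq_words (f := fun x => wmon [::] ⋄ x) (g := id)) => [||w ww] //.
  exact: rbmul_linr.
by rewrite rbmul_wcat.
Qed.

Lemma rbmul_w1r (x : H) : x ⋄ wmon [::] = x.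
Proof.
apply: (lin_eq_words (f := fun x => x ⋄ wmon [::]) (g := id)) => [||w ww] //.
  exact: rbmul_linl.
by rewrite rbmul_wcat; rewrite ?cats0.
Qed.

(** The first letter of [a :: w] takes part in a collision with [x] only if [w]
    is empty.  Otherwise the collision happens at the end of [w], and [a] is
    prepended to every term of [wmon w ⋄ x]. *)
Lemma rbmul_consA a w (x : H) : wf (a :: w) ->
  wmon (a :: w) ⋄ x = wmon [:: a] ⋄ (wmon w ⋄ x).
Proof.
move=> waw; have [wa ww] := wf_cons waw.
apply: (lin_eq_words (f := fun x => _ ⋄ x) (g := fun x => _ ⋄ (_ ⋄ x))).
- exact: rbmul_linr.
- exact: lin_comp (rbmul_linr _) (rbmul_linr _).
move=> {x} w' ww'.
case: w waw ww => [_ _|b w waw ww]; first by rewrite rbmul_w1l.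
have [wc|[p [z [t [s [wE wE']]]]]] := wf_cat ww ww'.
  have wac : wf (a :: (b :: w) ++ w').
    by move: waw; rewrite /= !wf_cons2 => /and3P[-> ->].
  rewrite (rbmul_wcat wc ww ww') rbmul_wcons //.
  exact: (rbmul_wcat (u := a :: b :: w) wac waw ww').
rewrite wE wE' in waw ww ww' *.
rewrite -rcons_cons in waw *.
rewrite (rbmul_brackets ww ww') (rbmul_brackets (p := a :: p) waw ww').
move: (_ + _) => R; move: R.
apply: lin_eq_basis.
- exact: linext_is_linear.
- exact: lin_comp (rbmul_linr _) (linext_is_linear _).
move=> r; rewrite !linext_basis; rewrite rbmul_wcons //.
by apply: (wf_glue (p := a :: p) waw ww'); apply: wf_val.
Qed.

Lemma rbmulP_wmonE (x : H) s : wf (Br [::] :: s) ->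
  rbP x ⋄ wmon s = linext (fun z : rbw X => wmon (Br (val z) :: s)) x.
Proof.
move=> ws; apply: (lin_eq_basis (f := fun x => rbP x ⋄ wmon s)) x.
- exact: lin_comp (rbmul_linl _) rbP_lin.
- exact: linext_is_linear.
move=> r; rewrite linext_basis -wmon_val; rewrite (rbP_wmon (wf_val r)) rbmul_wcons //.
by rewrite wf_br wf_val.
Qed.

(** The Rota-Baxter identity with a single outer P, the form in which a product
    of two brackets can again be treated as a bracket. *)
Lemma rbmul_RB (x y : H) : rbP x ⋄ rbP y = rbP (rbP x ⋄ y + x ⋄ rbP y).
Proof. by rewrite (linD rbP_lin) rbmulE rbPE; apply: diamond_PP. Qed.

(** A tail that may follow a bracket is carried along unchanged when two
    brackets are multiplied; this and the next lemma are associativity for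
    such tails. *)
Lemma rbmulPP_wmonA (x y : H) s : wf (Br [::] :: s) ->
  rbP x ⋄ (rbP y ⋄ wmon s) = (rbP x ⋄ rbP y) ⋄ wmon s.
Proof.
move=> ws; have wss := wf_brs ws.
apply: (lin_eq_words (f := fun x => rbP x ⋄ (rbP y ⋄ wmon s))
  (g := fun x => (rbP x ⋄ rbP y) ⋄ wmon s)) x.
- exact: lin_comp (rbmul_linl _) rbP_lin.
- exact: lin_comp (rbmul_linl _) (lin_comp (rbmul_linl _) rbP_lin).
move=> u wu.
apply: (lin_eq_words (f := fun y => rbP (wmon u) ⋄ (rbP y ⋄ wmon s))
  (g := fun y => (rbP (wmon u) ⋄ rbP y) ⋄ wmon s)) y.
- exact: lin_comp (rbmul_linr _) (lin_comp (rbmul_linl _) rbP_lin).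
- exact: lin_comp (rbmul_linl _) (lin_comp (rbmul_linr _) rbP_lin).
move=> v wv.
have wvs : wf (Br v :: s) by rewrite wf_br wv.
rewrite rbmul_RB.
rewrite (rbP_wmon wu) (rbP_wmon wv) (rbmulP_wmonE _ ws).
rewrite (rbmul_wcons wvs) (rbmul_brackets (p := [::])) //.
by rewrite wf_br1.
Qed.

Lemma rbmulP_wmonA (x z : H) s : wf (Br [::] :: s) ->
  (rbP x ⋄ wmon s) ⋄ z = rbP x ⋄ (wmon s ⋄ z).
Proof.
move=> ws; have wss := wf_brs ws.
apply: (lin_eq_words (f := fun x => (rbP x ⋄ wmon s) ⋄ z)
  (g := fun x => rbP x ⋄ (wmon s ⋄ z))) x.
- exact: lin_comp (rbmul_linl _) (lin_comp (rbmul_linl _) rbP_lin).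
- exact: lin_comp (rbmul_linl _) rbP_lin.
move=> u wu; have wus : wf (Br u :: s) by rewrite wf_br wu.
rewrite (rbP_wmon wu) (rbmul_wcons wus).
exact: rbmul_consA.
Qed.

Lemma Hdeg_wmon n w : wdeg w = n -> Hdeg n (wmon w).
Proof.
move=> <-; rewrite wmonE /wbasis; case: (@insubP _ _ (rbw X) w) => [z _ zE|_]; last exact: homog0.
by rewrite -zE; exact: (@homog_basis k _ (@deg X) z).
Qed.

Lemma Hdeg_image n m (f : H -> H) x : linear f -> Hdeg n x ->
  (forall w, wf w -> wdeg w = n -> Hdeg m (f (wmon w))) -> Hdeg m (f x).
Proof.
move=> lf hx hf; apply: (homog_image lf hx) => b db.
by rewrite -wmon_val; apply: hf => //; apply: wf_val.
Qed.

Lemma lin_eq_hwords n (V : lmodType k) (f g : H -> V) x :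
  linear f -> linear g -> Hdeg n x ->
  (forall w, wf w -> wdeg w = n -> f (wmon w) = g (wmon w)) -> f x = g x.
Proof.
move=> lf lg hx fg; apply: (lin_eq_homog lf lg hx) => b db.
by rewrite -wmon_val; apply: fg => //; apply: wf_val.
Qed.

Lemma Hdeg_P n (x : H) : Hdeg n x -> Hdeg n.+1 (rbP x).
Proof.
move=> hx; apply: Hdeg_image rbP_lin hx _ => w ww dw.
by rewrite rbP_wmon //; apply: Hdeg_wmon; rewrite wdeg_br dw.
Qed.

(** When two brackets meet, one pair of brackets is lost at the junction and
    recovered by the outer P, so the degree is preserved term by term. *)
Lemma Hdeg_rbmul d e (x y : H) : Hdeg d x -> Hdeg e y -> Hdeg (d + e)%N (x ⋄ y).
Proof.
have [n le_n] := ubnP (d + e)%N; elim: n => // n IH in d e le_n x y *.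
move=> hx hy.
apply: (Hdeg_image (f := fun x => x ⋄ y)) hx _ => [|w ww dw].
  exact: rbmul_linl.
apply: (Hdeg_image (f := fun y => wmon w ⋄ y)) hy _ => [|w' ww' dw'].
  exact: rbmul_linr.
have [wc|[r [u [v [s [wE wE']]]]]] := wf_cat ww ww'.
  by rewrite rbmul_wcat //; apply: Hdeg_wmon; rewrite wdeg_cat dw dw'.
rewrite wE wE' in ww ww' *.
rewrite (rbmul_brackets ww ww').
have dp : d = (wdeg r + (wdeg u).+1)%N by rewrite -dw wE -cats1 wdeg_cat wdeg_br.
have dq : e = ((wdeg v).+1 + wdeg s)%N by rewrite -dw' wE' -cat1s wdeg_cat wdeg_br.
apply: (Hdeg_image (n := (wdeg u + wdeg v).+1)).
- exact: linext_is_linear.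
- have lt1 : ((wdeg u).+1 + wdeg v < n)%N by rewrite dp dq in le_n; lia.
  have lt2 : (wdeg u + (wdeg v).+1 < n)%N by rewrite dp dq in le_n; lia.
  apply: homogD; [rewrite -addSn|rewrite -addnS]; apply: IH => //;
    by apply: Hdeg_wmon; rewrite ?wdeg_br.
move=> z wz dz; have [t tE] := rbw_of wz.
rewrite -tE wmon_val linext_basis; apply: Hdeg_wmon.
rewrite wdeg_cat wdeg_cons wdeg_br tE dz dp dq; lia.
Qed.

End ProductOnWords.

(** * Associativity *)
Section Associativity.
Context {k : comPzRingType} {X : Type}.
Implicit Types (w u v t p s : word X) (a : letter X).
Local Notation H := (freemod k (rbw X)).
Local Notation wmon := (@wmon k X).
Local Notation rbP := (@rbP k X).
Local Notation "x ⋄ y" := (@rbmul k X x y) (at level 40, left associativity).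

(** The induction hypothesis concerns words only, since the instances needed
    when three brackets meet are products of words.  The steps in between are
    about homogeneous elements, because they are applied to products. *)
Let assoc_words n := forall u v t, wf u -> wf v -> wf t ->
  (wdeg u + wdeg v + wdeg t < n)%N ->
  wmon u ⋄ (wmon v ⋄ wmon t) = (wmon u ⋄ wmon v) ⋄ wmon t.

(** Expanding (P x * P y) * P z and P x * (P y * P z) with the Rota-Baxter rule
    gives P applied to sums of three products, matched by associativity for
    (P x, P y, z), (P x, y, P z) and (x, P y, P z), all of degree one less. *)
Let assoc_brackets n u v t : assoc_words n -> wf u -> wf v -> wf t ->
  (wdeg [:: Br u] + wdeg [:: Br v] + wdeg [:: Br t] <= n)%N ->
  wmon [:: Br u] ⋄ (wmon [:: Br v] ⋄ wmon [:: Br t]) =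
  (wmon [:: Br u] ⋄ wmon [:: Br v]) ⋄ wmon [:: Br t].
Proof.
move=> IH wu wv wt le_n; rewrite !wdeg_br in le_n.
have A1 : wmon [:: Br u] ⋄ (wmon [:: Br v] ⋄ wmon t) =
          (wmon [:: Br u] ⋄ wmon [:: Br v]) ⋄ wmon t.
  by apply: IH; rewrite ?wf_br1 ?wdeg_br //; lia.
have A2 : wmon [:: Br u] ⋄ (wmon v ⋄ wmon [:: Br t]) =
          (wmon [:: Br u] ⋄ wmon v) ⋄ wmon [:: Br t].
  by apply: IH; rewrite ?wf_br1 ?wdeg_br //; lia.
have A3 : wmon u ⋄ (wmon [:: Br v] ⋄ wmon [:: Br t]) =
          (wmon u ⋄ wmon [:: Br v]) ⋄ wmon [:: Br t].
  by apply: IH; rewrite ?wf_br1 ?wdeg_br //; lia.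
move: A1 A2 A3; rewrite -!rbP_wmon //.
move: (wmon u) (wmon v) (wmon t) => x y z.
rewrite !rbmul_RB !(linD (rbmul_linl _)) !(linD (rbmul_linr _)).
rewrite !(linD rbP_lin) => A1 A2 A3.
by rewrite A1 A2 A3 addrA.
Qed.

(** Only the first letter of [x] matters.  If it is not a bracket, [x] is a tail
    carried along; if it is a bracket, the rest of [x] is. *)
Let assoc_PP n u v d (x : H) : assoc_words n -> wf u -> wf v -> Hdeg d x ->
  (wdeg [:: Br u] + wdeg [:: Br v] + d <= n)%N ->
  wmon [:: Br u] ⋄ (wmon [:: Br v] ⋄ x) = (wmon [:: Br u] ⋄ wmon [:: Br v]) ⋄ x.
Proof.
move=> IH wu wv hx le_n.
apply: (lin_eq_hwords (f := fun x => _ ⋄ (_ ⋄ x)) (g := fun x => _ ⋄ x) _ _ hx).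
- exact: lin_comp (rbmul_linr _) (rbmul_linr _).
- exact: rbmul_linr.
move=> w ww dw; have [wbw|nbw] := boolP (wf (Br [::] :: w)).
  by rewrite -!rbP_wmon // rbmulPP_wmonA.
case: w ww dw nbw => [//|[x0|t] s] ww dw nbw; first by rewrite wf_cons2 ww in nbw.
have [wt ws] : wf t /\ wf (Br [::] :: s) by apply/andP; rewrite -wf_br.
have ht : wmon [:: Br u] ⋄ (wmon [:: Br v] ⋄ wmon [:: Br t]) =
  (wmon [:: Br u] ⋄ wmon [:: Br v]) ⋄ wmon [:: Br t].
  apply: (assoc_brackets IH) => //; move: le_n; rewrite -dw (wdeg_cons _ s); lia.
move: ht; rewrite -(rbmul_wcons ww) -!rbP_wmon //.
move: (wmon u) (wmon v) (wmon t) => {wu wv wt} x1 x2 x3 ht.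
(* Each product of two brackets is turned into one bracket, so that the tail
   can be moved past it. *)
by rewrite rbmulPP_wmonA // rbmul_RB rbmulPP_wmonA // -rbmul_RB ht
   [_ x1 ⋄ _ x2]rbmul_RB rbmulPP_wmonA // -rbmul_RB.
Qed.

Let assoc_letter n a d e (x y : H) : assoc_words n -> wf [:: a] ->
  Hdeg d x -> Hdeg e y -> (wdeg [:: a] + d + e <= n)%N ->
  wmon [:: a] ⋄ (x ⋄ y) = (wmon [:: a] ⋄ x) ⋄ y.
Proof.
move=> IH wa hx hy le_n.
apply: (lin_eq_hwords (f := fun x => _ ⋄ (x ⋄ y))
  (g := fun x => (_ ⋄ x) ⋄ y) _ _ hx).
- exact: lin_comp (rbmul_linr _) (rbmul_linl _).
- exact: lin_comp (rbmul_linl _) (rbmul_linr _).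
move=> w ww dw; have [waw|] := wf_cat wa ww.
  by rewrite rbmul_wcons // -rbmul_consA.
move=> [p [u [v [s [aE wE]]]]]; case: p aE => [|b []//] [aE]; subst a w.
have wu : wf u by rewrite -wf_br1.
have [wv ws] : wf v /\ wf (Br [::] :: s) by apply/andP; rewrite -wf_br.
have hsy : Hdeg (wdeg s + e) (wmon s ⋄ y).
  by apply: Hdeg_rbmul => //; apply: Hdeg_wmon.
have ht : wmon [:: Br u] ⋄ (wmon [:: Br v] ⋄ (wmon s ⋄ y)) =
  (wmon [:: Br u] ⋄ wmon [:: Br v]) ⋄ (wmon s ⋄ y).
  apply: (assoc_PP IH wu wv hsy); move: le_n; rewrite -dw (wdeg_cons _ s); lia.
move: ht; rewrite -(rbmul_wcons ww) -!rbP_wmon //.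
move: (wmon u) (wmon v) => {wu wv} x1 x2 ht.
by rewrite rbmulP_wmonA // ht rbmulPP_wmonA // rbmul_RB -rbmulP_wmonA.
Qed.

Let assoc_wordsP n : assoc_words n.
Proof.
elim: n => [|n IH] u v t wu wv wt //.
elim: u wu => [|a u IHu] wau le_n; first by rewrite !rbmul_w1l.
have [wa wu] := wf_cons wau; rewrite wdeg_cons in le_n.
have lt_n : (wdeg u + wdeg v + wdeg t < n.+1)%N by have := wdeg_gt0 a; lia.
rewrite !(rbmul_consA _ wau) (IHu wu lt_n).
have huv : Hdeg (wdeg u + wdeg v) (wmon u ⋄ wmon v).
  by apply: Hdeg_rbmul; apply: Hdeg_wmon.
apply: (assoc_letter IH wa huv (Hdeg_wmon (erefl (wdeg t)))); lia.
Qed.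

Lemma rbmulA : associative (@rbmul k X).
Proof.
move=> x y z.
apply: (lin_eq_words (f := fun x => x ⋄ (y ⋄ z)) (g := fun x => (x ⋄ y) ⋄ z)) x.
- exact: rbmul_linl.
- exact: lin_comp (rbmul_linl _) (rbmul_linl _).
move=> u wu.
apply: (lin_eq_words (f := fun y => _ ⋄ (y ⋄ z)) (g := fun y => (_ ⋄ y) ⋄ z)) y.
- exact: lin_comp (rbmul_linr _) (rbmul_linl _).
- exact: lin_comp (rbmul_linl _) (rbmul_linr _).
move=> v wv.
apply: (lin_eq_words (f := fun z => _ ⋄ (_ ⋄ z)) (g := fun z => _ ⋄ z)) z.
- exact: lin_comp (rbmul_linr _) (rbmul_linr _).
- exact: rbmul_linr.
by move=> t wt; apply: (@assoc_wordsP _.+1) => //.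
Qed.
End Associativity.

(** * Multiplicative maps out of the algebra *)
Section Multiplicativity.
Context {k : comPzRingType} {X : Type}.
Implicit Types (w u v t p s : word X) (a : letter X).
Local Notation H := (freemod k (rbw X)).
Local Notation wmon := (@wmon k X).
Local Notation rbP := (@rbP k X).
Local Notation "x ⋄ y" := (@rbmul k X x y) (at level 40, left associativity).
Context {V : lmodType k} (m : V -> V -> V) (f : H -> V).
Hypotheses (bm : bilin m) (mA : associative m) (lf : linear f).
Hypotheses (f1 : left_id (f (wmon [::])) m)
  (fcons : forall a w, wf (a :: w) ->
    f (wmon (a :: w)) = m (f (wmon [:: a])) (f (wmon w)))
  (fRB : forall u v, wf u -> wf v ->
    f (rbP (wmon u) ⋄ wmon v) = m (f (rbP (wmon u))) (f (wmon v)) ->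
    f (wmon u ⋄ rbP (wmon v)) = m (f (wmon u)) (f (rbP (wmon v))) ->
    f (rbP (wmon u) ⋄ rbP (wmon v)) = m (f (rbP (wmon u))) (f (rbP (wmon v)))).

Let mlinl y : linear (fun x => m x y). Proof. exact: bm.2. Qed.
Let mlinr x : linear (m x). Proof. exact: bm.1. Qed.

Let f_Pcat (x : H) s : wf (Br [::] :: s) ->
  f (rbP x ⋄ wmon s) = m (f (rbP x)) (f (wmon s)).
Proof.
move=> ws; have wss := wf_brs ws.
apply: (lin_eq_words (f := fun x => f (rbP x ⋄ wmon s)) (g := fun x => m (f (rbP x)) _)) x.
- exact: lin_comp lf (lin_comp (rbmul_linl _) rbP_lin).
- exact: lin_comp (mlinl _) (lin_comp lf rbP_lin).
move=> u wu; have wus : wf (Br u :: s) by rewrite wf_br wu.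
by rewrite (rbP_wmon wu) (rbmul_wcons wus) fcons.
Qed.

(** Same reduction as for associativity: peel off letters of the left factor
    until two brackets meet, where the hypothesis [fRB] takes over.  Its two
    premises concern products of smaller degree. *)
Lemma rb_multiplicative (x y : H) : f (x ⋄ y) = m (f x) (f y).
Proof.
suff fw n u v : wf u -> wf v -> (wdeg u + wdeg v < n)%N ->
    f (wmon u ⋄ wmon v) = m (f (wmon u)) (f (wmon v)).
  apply: (lin_eq_words (f := fun x => f (x ⋄ y)) (g := fun x => m (f x) (f y))) x.
  - exact: lin_comp lf (rbmul_linl _).
  - exact: lin_comp (mlinl _) lf.
  move=> u wu; apply: (lin_eq_words (f := fun y => f (_ ⋄ y)) (g := fun y => m _ (f y))) y.
  - exact: lin_comp lf (rbmul_linr _).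
  - exact: lin_comp (mlinr _) lf.
  by move=> v wv; apply: (fw _.+1).
elim: n => // n IH in u v *; move=> {x y} wu wv.
have letter a d y : wf [:: a] -> Hdeg d y -> (wdeg [:: a] + d <= n)%N ->
    f (wmon [:: a] ⋄ y) = m (f (wmon [:: a])) (f y).
  move=> wa hy le_n.
  apply: (lin_eq_hwords (f := fun y => f (_ ⋄ y)) (g := fun y => m _ (f y)) _ _ hy).
  - exact: lin_comp lf (rbmul_linr _).
  - exact: lin_comp (mlinr _) lf.
  move=> w ww dw; have [waw|] := wf_cat wa ww.
    by rewrite rbmul_wcons // fcons.
  move=> [p [b [c [s [aE wE]]]]]; case: p aE => [|? []//] [aE]; subst a w.
  have wb : wf b by rewrite -wf_br1.
  have [wc ws] : wf c /\ wf (Br [::] :: s) by apply/andP; rewrite -wf_br.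
  have le_s : ((wdeg b).+1 + (wdeg c).+1 <= n)%N.
    by move: le_n; rewrite -dw (wdeg_cons _ s) !wdeg_br; lia.
  rewrite -(rbmul_wcons ww) rbmulA -!rbP_wmon // f_Pcat // mA -fRB //.
  - by rewrite rbmul_RB f_Pcat.
  - by rewrite rbP_wmon //; apply: IH; rewrite ?wf_br1 ?wdeg_br //; lia.
  - by rewrite rbP_wmon //; apply: IH; rewrite ?wf_br1 ?wdeg_br //; lia.
elim: u wu => [|a u IHu] wau le_n; first by rewrite rbmul_w1l f1.
have [wa wu] := wf_cons wau; rewrite wdeg_cons in le_n.
have huv : Hdeg (wdeg u + wdeg v) (wmon u ⋄ wmon v).
  by apply: Hdeg_rbmul; apply: Hdeg_wmon.
have lt_n : (wdeg u + wdeg v < n.+1)%N by have := wdeg_gt0 a; lia.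
rewrite (rbmul_consA _ wau) (letter _ _ _ wa huv); last by rewrite addnA.
by rewrite (IHu wu lt_n) mA -fcons.
Qed.
End Multiplicativity.

(** * The coproduct *)
HB.lock Definition rbDelta (k : comPzRingType) (X : Type) :
  freemod k (rbw X) -> freemod k (rbw X * rbw X)%type := @Delta k X.

Section Coproduct.
Context {k : comPzRingType} {X : Type}.
Implicit Types (w u v t p s : word X) (a : letter X).
Local Notation H := (freemod k (rbw X)).
Local Notation HH := (freemod k (rbw X * rbw X)%type).
Local Notation wmon := (@wmon k X).
Local Notation rbP := (@rbP k X).
Local Notation "x ⋄ y" := (@rbmul k X x y) (at level 40, left associativity).
Local Notation one := (wmon [::]).
Local Notation m2 := (tmul (@rbmul k X) (@rbmul k X)).
Local Notation IP := (tmap (@id H) rbP).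

Local Notation rbDelta := (@rbDelta k X).
Lemma rbDeltaE : rbDelta = @Delta k X. Proof. by rewrite rbDelta.unlock. Qed.
Lemma rbDelta_lin : linear rbDelta.
Proof. by rewrite rbDeltaE; exact: linext_is_linear. Qed.

Lemma wmon1E : one = basis rbw1.
Proof. exact: (wmon_val rbw1). Qed.

Let m2_linl z : linear (fun x => m2 x z). Proof. exact: tmul_linl. Qed.
Let m2_linr z : linear (m2 z). Proof. exact: tmul_linr. Qed.
Let bm := @rbmul_bilin k X.
Let IP_lin : linear IP. Proof. exact: tmap_lin. Qed.
Let IP_otimes (x y : H) : IP (x ⊗ y) = x ⊗ rbP y.
Proof. exact: (tmap_otimes (f := @id H) (g := rbP) x y (fun _ _ _ => erefl) rbP_lin). Qed.

Lemma rbmul2A : associative m2. Proof. by apply: tmulA => //; exact: rbmulA. Qed.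
Lemma rbmul2_1l : left_id (one ⊗ one) m2.
Proof. by apply: tmul1l => // x; exact: rbmul_w1l. Qed.
Lemma rbmul2_1r : right_id (one ⊗ one) m2.
Proof. by apply: tmul1r => // x; exact: rbmul_w1r. Qed.

Let Delta_wordE w : wf w -> rbDelta (wmon w) = Delta_word k w.
Proof.
move=> /rbw_of[z <-]; rewrite wmon_val rbDeltaE /Delta.
exact: linext_basis.
Qed.

Let Delta_word_cons a w :
  Delta_word k (a :: w) = m2 (Delta_letter k a) (Delta_word k w).
Proof. by rewrite rbmulE tmulE. Qed.

Let Delta_word0 : Delta_word k [::] = one ⊗ one.
Proof. by rewrite wmon1E otimesE. Qed.

Lemma rbDelta1 : rbDelta one = one ⊗ one.
Proof. by rewrite Delta_wordE. Qed.

Let Delta_letterE a : wf [:: a] -> Delta_letter k a = rbDelta (wmon [:: a]).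
Proof. by move=> wa; rewrite Delta_wordE // Delta_word_cons Delta_word0 rbmul2_1r. Qed.

Lemma rbDelta_cons a w : wf (a :: w) ->
  rbDelta (wmon (a :: w)) = m2 (rbDelta (wmon [:: a])) (rbDelta (wmon w)).
Proof.
move=> waw; have [wa ww] := wf_cons waw.
by rewrite (Delta_wordE waw) Delta_word_cons (Delta_letterE wa) (Delta_wordE ww).
Qed.

Lemma rbDelta_var x :
  rbDelta (wmon [:: Var x]) = wmon [:: Var x] ⊗ one + one ⊗ wmon [:: Var x].
Proof. by rewrite -Delta_letterE // wmon1E wmonE otimesE. Qed.

(** The cocycle rule, extended from words to all elements. *)
Lemma rbDelta_P (x : H) : rbDelta (rbP x) = rbP x ⊗ one + IP (rbDelta x).
Proof.
apply: (lin_eq_words (f := fun x => rbDelta (rbP x))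
  (g := fun x => rbP x ⊗ one + IP (rbDelta x))) x.
- exact: lin_comp rbDelta_lin rbP_lin.
- apply: lin_add; first exact: lin_comp (otimes_linl _) rbP_lin.
  exact: lin_comp IP_lin rbDelta_lin.
move=> u wu; rewrite (rbP_wmon wu) (Delta_wordE wu) -Delta_letterE ?wf_br1 //.
by rewrite wmon1E wmonE otimesE tmapE rbPE.
Qed.

(** When [A] and [B] are the coproducts of [a] and [b], the two factors on the
    left are the coproducts of the brackets P a and P b.  The identity says that
    id ⊗ P is a Rota-Baxter operator which moreover commutes with products by
    elements x ⊗ 1. *)
Lemma IP_RB (A B : HH) (a b : H) :
  m2 (rbP a ⊗ one + IP A) (rbP b ⊗ one + IP B) =
  (rbP a ⋄ rbP b) ⊗ one +
  IP (m2 (rbP a ⊗ one + IP A) B + m2 A (rbP b ⊗ one + IP B)).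
Proof.
have E1 : IP (m2 (rbP a ⊗ one) B) = m2 (rbP a ⊗ one) (IP B).
  apply: (lin_eq_otimes (f := fun B => IP (m2 (rbP a ⊗ one) B))
    (g := fun B => m2 _ (IP B))) B => [||x y].
  - exact: lin_comp IP_lin (m2_linr _).
  - exact: lin_comp (m2_linr _) IP_lin.
  - by rewrite IP_otimes !(tmul_otimes bm bm) IP_otimes !rbmul_w1l.
have E2 : IP (m2 A (rbP b ⊗ one)) = m2 (IP A) (rbP b ⊗ one).
  apply: (lin_eq_otimes (f := fun A => IP (m2 A (rbP b ⊗ one)))
    (g := fun A => m2 (IP A) _)) A => [||x y].
  - exact: lin_comp IP_lin (m2_linl _).
  - exact: lin_comp (m2_linl _) IP_lin.
  - by rewrite IP_otimes !(tmul_otimes bm bm) IP_otimes !rbmul_w1r.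
have E3 : IP (m2 (IP A) B) + IP (m2 A (IP B)) = m2 (IP A) (IP B).
  move: A B {E1 E2}; apply: (bilin_eq_otimes
    (f := fun A B => IP (m2 (IP A) B) + IP (m2 A (IP B)))
    (g := fun A B => m2 (IP A) (IP B))) => [||x x' y y'].
  - split=> [A|B] c v w;
    rewrite ?m2_linl ?IP_lin ?m2_linr ?m2_linl ?IP_lin ?m2_linr ?IP_lin;
    by rewrite scalerDr addrACA.
  - by split=> [A|B] c v w; rewrite ?m2_linl ?IP_lin ?m2_linr ?m2_linl.
  rewrite !IP_otimes !(tmul_otimes bm bm) !IP_otimes rbmul_RB.
  by rewrite (linD rbP_lin) (linD (otimes_linr _)).
rewrite (linD (m2_linl _)) !(linD (m2_linr _)) !(linD IP_lin).
rewrite !(linD (m2_linl _)) !(linD IP_lin).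
rewrite E1 E2 -E3 (tmul_otimes bm bm) rbmul_w1l.
by rewrite -addrA [X in _ + X]addrA [X in _ + X = _]addrACA.
Qed.

Lemma rbDeltaM (x y : H) : rbDelta (x ⋄ y) = m2 (rbDelta x) (rbDelta y).
Proof.
apply: rb_multiplicative => [||||a w waw|u v _ _ Eu Ev].
- exact: tmul_bilin.
- exact: rbmul2A.
- exact: rbDelta_lin.
- by rewrite rbDelta1; exact: rbmul2_1l.
- exact: rbDelta_cons.
rewrite rbmul_RB rbDelta_P (linD rbDelta_lin) Eu Ev !rbDelta_P.
by rewrite IP_RB rbmul_RB.
Qed.

Local Notation m3 := (tmul (@rbmul k X) m2).
(** The two sides of coassociativity, [dl] and [dr], are maps on the tensor
    square, and both are multiplicative.  [dl] turns id ⊗ P into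
    id ⊗ (id ⊗ P); [dr] does so up to the extra term in [dr_IP], which matches
    what [dl] produces from the summand P x ⊗ 1 of the coproduct of P x. *)
Let dl (z : HH) := tassoc (tmap rbDelta (@id H) z).
Local Notation dr := (tmap (@id H) rbDelta).

Let lin_idH : linear (@id H). Proof. by []. Qed.
Let dl_lin : linear dl.
Proof. by move=> c x y; rewrite /dl tmap_lin tassoc_lin. Qed.
Let dr_lin : linear dr. Proof. exact: tmap_lin. Qed.
Let b2 : bilin m2. Proof. exact: tmul_bilin. Qed.
Let m3_linl z : linear (fun x => m3 x z). Proof. exact: tmul_linl. Qed.
Let m3_linr z : linear (m3 z). Proof. exact: tmul_linr. Qed.

Let dr_otimes (x y : H) : dr (x ⊗ y) = x ⊗ rbDelta y.
Proof. exact: (tmap_otimes (f := @id H) x y lin_idH rbDelta_lin). Qed.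
Let dl_otimes (x y : H) : dl (x ⊗ y) = tassoc (rbDelta x ⊗ y).
Proof.
by rewrite /dl (tmap_otimes (f := rbDelta) (g := @id H) x y rbDelta_lin lin_idH).
Qed.

Let drM z z' : dr (m2 z z') = m3 (dr z) (dr z').
Proof.
apply: (bilin_eq_otimes (f := fun z z' => dr (m2 z z'))
    (g := fun z z' => m3 (dr z) (dr z'))) => [||x y x' y'].
- by split=> t c v w; rewrite ?m2_linl ?m2_linr dr_lin.
- by split=> t c v w; rewrite dr_lin ?m3_linl ?m3_linr.
by rewrite (tmul_otimes bm bm) !dr_otimes rbDeltaM (tmul_otimes bm b2).
Qed.

Let tassocM z z' (y y' : H) :
  tassoc (m2 z z' ⊗ (y ⋄ y')) = m3 (tassoc (z ⊗ y)) (tassoc (z' ⊗ y')).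
Proof.
apply: (bilin_eq_otimes (f := fun z z' => tassoc (m2 z z' ⊗ (y ⋄ y')))
    (g := fun z z' => m3 (tassoc (z ⊗ y)) (tassoc (z' ⊗ y')))) => [||x1 x2 x1' x2'].
- by split=> t c v w; rewrite ?m2_linl ?m2_linr otimes_linl tassoc_lin.
- by split=> t c v w; rewrite otimes_linl tassoc_lin ?m3_linl ?m3_linr.
by rewrite (tmul_otimes bm bm) !tassoc_otimes (tmul_otimes bm b2) (tmul_otimes bm bm).
Qed.

Let dlM z z' : dl (m2 z z') = m3 (dl z) (dl z').
Proof.
apply: (bilin_eq_otimes (f := fun z z' => dl (m2 z z'))
    (g := fun z z' => m3 (dl z) (dl z'))) => [||x y x' y'].
- by split=> t c v w; rewrite ?m2_linl ?m2_linr dl_lin.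
- by split=> t c v w; rewrite dl_lin ?m3_linl ?m3_linr.
by rewrite (tmul_otimes bm bm) !dl_otimes rbDeltaM tassocM.
Qed.

Let id_IP := tmap (@id H) IP.
Let id_IP_lin : linear id_IP. Proof. exact: tmap_lin. Qed.

Let dl_IP z : dl (IP z) = id_IP (dl z).
Proof.
apply: (lin_eq_otimes (f := fun z => dl (IP z)) (g := fun z => id_IP (dl z))) z
  => [||x y].
- exact: lin_comp dl_lin IP_lin.
- exact: lin_comp id_IP_lin dl_lin.
rewrite IP_otimes !dl_otimes; move: (rbDelta x) => z.
apply: (lin_eq_otimes (f := fun z => tassoc (z ⊗ _)) (g := fun z => id_IP (tassoc (z ⊗ y)))) z
  => [||a b].
- by move=> c u v; rewrite otimes_linl tassoc_lin.
- by move=> c u v; rewrite otimes_linl tassoc_lin id_IP_lin.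
rewrite !tassoc_otimes /id_IP (tmap_otimes (f := @id H) _ _ lin_idH IP_lin).
by rewrite IP_otimes.
Qed.

Let dr_IP z : dr (IP z) = tassoc (IP z ⊗ one) + id_IP (dr z).
Proof.
apply: (lin_eq_otimes (f := fun z => dr (IP z))
  (g := fun z => tassoc (IP z ⊗ one) + id_IP (dr z))) z => [||x y].
- exact: lin_comp dr_lin IP_lin.
- apply: lin_add; last exact: lin_comp id_IP_lin dr_lin.
  by move=> c u v; rewrite IP_lin otimes_linl tassoc_lin.
rewrite IP_otimes !dr_otimes rbDelta_P tassoc_otimes.
rewrite /id_IP (tmap_otimes (f := @id H) _ _ lin_idH IP_lin).
by rewrite (linD (otimes_linr _)).
Qed.

Lemma rbDelta_coassoc (x : H) :
  tassoc (tmap rbDelta (@id H) (rbDelta x)) = tmap (@id H) rbDelta (rbDelta x).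
Proof.
rewrite -/(dl _).
apply: (lin_eq_words (f := fun x => dl (rbDelta x)) (g := fun x => dr (rbDelta x))) x.
- exact: lin_comp dl_lin rbDelta_lin.
- exact: lin_comp dr_lin rbDelta_lin.
apply: word_ind => [|x|u wu IH|a w _ waw IHa IHw].
- by rewrite !rbDelta1 dl_otimes dr_otimes !rbDelta1 tassoc_otimes.
- rewrite !rbDelta_var (linD dl_lin) (linD dr_lin) !dl_otimes !dr_otimes.
  rewrite !rbDelta_var !rbDelta1 (linD (otimes_linl _)) (linD (@tassoc_lin k _ _ _)).
  by rewrite !tassoc_otimes (linD (otimes_linr _)) addrA.
- rewrite -(rbP_wmon wu) !rbDelta_P (linD dl_lin) (linD dr_lin) dl_otimes dr_otimes.
  rewrite rbDelta_P dl_IP dr_IP IH rbDelta1 (linD (otimes_linl _)).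
  by rewrite (linD (@tassoc_lin k _ _ _)) tassoc_otimes addrA.
- by rewrite (rbDelta_cons waw) dlM drM IHa IHw.
Qed.

End Coproduct.

(** * Counit and grading of the coproduct *)
Section Counit.
Context {k : comPzRingType} {X : Type}.
Implicit Types (w u v t p s : word X) (a : letter X).
Local Notation H := (freemod k (rbw X)).
Local Notation HH := (freemod k (rbw X * rbw X)%type).
Local Notation wmon := (@wmon k X).
Local Notation rbP := (@rbP k X).
Local Notation rbDelta := (@rbDelta k X).
Local Notation "x ⋄ y" := (@rbmul k X x y) (at level 40, left associativity).
Local Notation one := (wmon [::]).
Local Notation m2 := (tmul (@rbmul k X) (@rbmul k X)).
Local Notation eps := (@eps k X).

Lemma eps_lin : scalar eps.
Proof. by move=> c x y; rewrite /eps mcoeffD fcoeffZ. Qed.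

Lemma eps_wmon w : wf w -> eps (wmon w) = (nilp w)%:R.
Proof.
move=> /rbw_of[z <-]; rewrite wmon_val eps_basis; congr (nat_of_bool _)%:R.
by apply/eqP/nilP => [->|z0] //; apply: val_inj.
Qed.

Lemma eps_P (x : H) : eps (rbP x) = 0.
Proof.
apply: (lin_eq_words (V := k^o) (f := fun x => eps (rbP x)) (g := fun=> 0)) x.
- by move=> c x y; rewrite rbP_lin eps_lin.
- by move=> c x y; rewrite scaler0 addr0.
by move=> w ww; rewrite rbP_wmon // eps_wmon ?wf_br1.
Qed.

Lemma epsM (x y : H) : eps (x ⋄ y) = eps x * eps y.
Proof.
apply: (rb_multiplicative (V := k^o) (m := *%R) (f := eps))
  => [||||a w waw|u v _ _ _ _].
- split=> z c x' y' /=; first by rewrite mulrDr; congr (_ + _); exact: mulrCA.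
  by rewrite mulrDl; congr (_ + _); exact/esym/mulrA.
- exact: mulrA.
- exact: eps_lin.
- by move=> c; rewrite eps_wmon // mul1r.
- have [wa ww] := wf_cons waw.
  by rewrite !eps_wmon // mul0r.
by rewrite rbmul_RB !eps_P mul0r.
Qed.

Let bm := @rbmul_bilin k X.
Local Notation cl := (tcounitl eps).
Local Notation cr := (tcounitr eps).

Let clM z z' : cl (m2 z z') = cl z ⋄ cl z'.
Proof.
apply: (bilin_eq_otimes (f := fun z z' => cl (m2 z z'))
    (g := fun z z' => cl z ⋄ cl z')) => [||x y x' y'].
- by split=> t c v w; rewrite ?tmul_linl ?tmul_linr tcounitl_lin.
- by split=> t c v w; rewrite tcounitl_lin ?rbmul_linl ?rbmul_linr.
rewrite (tmul_otimes bm bm) !(tcounitl_otimes _ _ eps_lin) epsM.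
by rewrite (linZ (rbmul_linl _)) (linZ (rbmul_linr _)) scalerA.
Qed.

Let crM z z' : cr (m2 z z') = cr z ⋄ cr z'.
Proof.
apply: (bilin_eq_otimes (f := fun z z' => cr (m2 z z'))
    (g := fun z z' => cr z ⋄ cr z')) => [||x y x' y'].
- by split=> t c v w; rewrite ?tmul_linl ?tmul_linr tcounitr_lin.
- by split=> t c v w; rewrite tcounitr_lin ?rbmul_linl ?rbmul_linr.
rewrite (tmul_otimes bm bm) !(tcounitr_otimes _ _ eps_lin) epsM.
by rewrite (linZ (rbmul_linl _)) (linZ (rbmul_linr _)) scalerA.
Qed.

Let lin_idH : linear (@id H). Proof. by []. Qed.
Let IP_otimes (x y : H) : tmap (@id H) rbP (x ⊗ y) = x ⊗ rbP y.
Proof. exact: (tmap_otimes (f := @id H) x y lin_idH rbP_lin). Qed.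

Let cl_IP z : cl (tmap (@id H) rbP z) = rbP (cl z).
Proof.
apply: (lin_eq_otimes (f := fun z => cl (tmap (@id H) rbP z)) (g := fun z => rbP (cl z))) z
  => [||x y].
- by move=> c x y; rewrite tmap_lin tcounitl_lin.
- by move=> c x y; rewrite tcounitl_lin rbP_lin.
by rewrite IP_otimes !(tcounitl_otimes _ _ eps_lin) (linZ rbP_lin).
Qed.

Let cr_IP z : cr (tmap (@id H) rbP z) = 0.
Proof.
apply: (lin_eq_otimes (f := fun z => cr (tmap (@id H) rbP z)) (g := fun=> 0)) z
  => [||x y].
- by move=> c x y; rewrite tmap_lin tcounitr_lin.
- by move=> c x y; rewrite scaler0 addr0.
by rewrite IP_otimes !(tcounitr_otimes _ _ eps_lin) eps_P scale0r.
Qed.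

Lemma rbDelta_counitl (x : H) : cl (rbDelta x) = x.
Proof.
apply: (lin_eq_words (f := fun x => cl (rbDelta x)) (g := id)) x => [||w ww] //.
  by move=> c x y; rewrite rbDelta_lin tcounitl_lin.
move: w ww; apply: word_ind => [|x|u wu IH|a w _ waw IHa IHw].
- by rewrite rbDelta1 (tcounitl_otimes _ _ eps_lin) eps_wmon // scale1r.
- rewrite rbDelta_var (linD (tcounitl_lin _)) !(tcounitl_otimes _ _ eps_lin).
  by rewrite !eps_wmon // scale0r scale1r add0r.
- rewrite -(rbP_wmon wu) rbDelta_P (linD (tcounitl_lin _)) (tcounitl_otimes _ _ eps_lin).
  by rewrite eps_P scale0r add0r cl_IP IH.
- by rewrite (rbDelta_cons waw) clM IHa IHw (rbmul_wcons waw).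
Qed.

Lemma rbDelta_counitr (x : H) : cr (rbDelta x) = x.
Proof.
apply: (lin_eq_words (f := fun x => cr (rbDelta x)) (g := id)) x => [||w ww] //.
  by move=> c x y; rewrite rbDelta_lin tcounitr_lin.
move: w ww; apply: word_ind => [|x|u wu IH|a w _ waw IHa IHw].
- by rewrite rbDelta1 (tcounitr_otimes _ _ eps_lin) eps_wmon // scale1r.
- rewrite rbDelta_var (linD (tcounitr_lin _)) !(tcounitr_otimes _ _ eps_lin).
  by rewrite !eps_wmon // scale0r scale1r addr0.
- rewrite -(rbP_wmon wu) rbDelta_P (linD (tcounitr_lin _)) (tcounitr_otimes _ _ eps_lin).
  by rewrite eps_wmon // scale1r cr_IP addr0.
- by rewrite (rbDelta_cons waw) crM IHa IHw (rbmul_wcons waw).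
Qed.

Local Notation deg2 := (fun p : rbw X * rbw X => deg p.1 + deg p.2)%N.

Let homog_m2 n m z z' : homog deg2 n z -> homog deg2 m z' ->
  homog deg2 (n + m)%N (m2 z z').
Proof.
move=> hz hz'; apply: (homog_image (f := fun z => m2 z z')) hz _ => [|[a b] dab].
  exact: tmul_linl.
apply: (homog_image (f := m2 _)) hz' _ => [|[c d] dcd]; first exact: tmul_linr.
rewrite -!otimes_basis (tmul_otimes bm bm) -dab -dcd /= addnACA.
by apply: homog_otimes; apply: Hdeg_rbmul; apply: homog_basis.
Qed.

(** The coproduct is built from products, which add degrees, and from id ⊗ P,
    which raises the total degree of a tensor by one just as P does. *)
Lemma homog_rbDelta n x : Hdeg n x -> homog deg2 n (rbDelta x).
Proof.
move=> hx; apply: (homog_image rbDelta_lin hx) => b <- {n x hx}.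
rewrite -wmon_val; suff h w : wf w -> homog deg2 (wdeg w) (rbDelta (wmon w)).
  by apply: h; apply: wf_val.
have h1 : Hdeg 0 one by apply: Hdeg_wmon.
move: w; apply: word_ind => [|x|u wu IH|a w _ waw IHa IHw].
- by rewrite rbDelta1; apply: (homog_otimes (n := 0) (m := 0)).
- rewrite rbDelta_var; apply: homogD.
    by apply: (homog_otimes (n := 1) (m := 0)) => //; apply: Hdeg_wmon.
  by apply: (homog_otimes (n := 0) (m := 1)) => //; apply: Hdeg_wmon.
- rewrite -(rbP_wmon wu) rbDelta_P wdeg_br; apply: homogD.
    rewrite -[_.+1]addn0; apply: homog_otimes => //.
    by apply: Hdeg_P; apply: Hdeg_wmon.
  apply: (homog_image (tmap_lin _ _) IH) => -[c d] /= <-.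
  rewrite -otimes_basis IP_otimes -addnS; apply: homog_otimes; first exact: homog_basis.
  by apply: Hdeg_P; apply: homog_basis.
- by rewrite (rbDelta_cons waw) (wdeg_cons a w); apply: homog_m2.
Qed.

End Counit.

(** * Connected bialgebras are Hopf algebras *)
Section Antipode.
Context {k : comPzRingType} {B : choiceType}.
Local Notation H := (freemod k B).
Local Notation HH := (freemod k (B * B)%type).
Context (m : H -> H -> H) (u : k -> H) (D : H -> HH) (e : H -> k)
  (G : nat -> set H).
Hypothesis cb : is_connected_bialgebra m u D e G.

Let bialg := graded_bialg (connected_graded cb).
Let bm : bilin m := alg_mul_bilin (bialg_algebra bialg).
Let mlinl y : linear (fun x => m x y). Proof. exact: bm.2. Qed.
Let mlinr x : linear (m x). Proof. exact: bm.1. Qed.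
Let mA : associative m := alg_mulA (bialg_algebra bialg).
Let D_lin : linear D := coalg_Delta_linear (bialg_coalgebra bialg).
Let e_lin : scalar e := coalg_eps_linear (bialg_coalgebra bialg).
Let id_lin : linear (@id H). Proof. by []. Qed.

Let convol (f g : H -> H) (x : H) : H := tfold m (tmap f g (D x)).

Let convolE f g x : convol f g x = conv m D f g x.
Proof. by rewrite /convol /conv tfoldE tmapE. Qed.

Let convol_lin f g : linear (convol f g).
Proof. by move=> c x y; rewrite /convol D_lin tmap_lin tfold_lin. Qed.

Let tfold_tmap (f g : H -> H) (x y : H) :
  linear f -> linear g -> tfold m (tmap f g (x ⊗ y)) = m (f x) (g y).
Proof. by move=> lf lg; rewrite tmap_otimes // tfold_otimes. Qed.

(** Both sides arise by applying the triple product of f, g, h to the twofold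
    coproduct; associativity identifies the products and coassociativity the
    coproducts. *)
Let convolA f g h : linear f -> linear g -> linear h ->
  convol (convol f g) h = convol f (convol g h).
Proof.
move=> lf lg lh; apply/funext => x.
have lgh : linear (fun y => tfold m (tmap g h y)).
  by move=> c y z; rewrite tmap_lin tfold_lin.
pose T (z : freemod k (B * (B * B))%type) := tfold m (tmap f (fun y => tfold m (tmap g h y)) z).
have T_lin : linear T by move=> c y z; rewrite /T tmap_lin tfold_lin.
have T_otimes a y : T (a ⊗ y) = m (f a) (tfold m (tmap g h y)).
  by rewrite /T tmap_otimes // tfold_otimes.
have lcvfg := convol_lin f g; have lcvgh := convol_lin g h.
transitivity (T (tassoc (tmap D (@id H) (D x)))).
  apply: (lin_eq_otimes (f := fun z => tfold m (tmap (convol f g) h z))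
    (g := fun z => T (tassoc (tmap D (@id H) z)))) (D x) => [||a y].
  - by move=> c y z; rewrite tmap_lin tfold_lin.
  - by move=> c y z; rewrite tmap_lin tassoc_lin T_lin.
  rewrite tfold_tmap // (tmap_otimes (f := D) (g := @id H) _ _ D_lin id_lin) /convol.
  apply: (lin_eq_otimes (f := fun z => m (tfold m (tmap f g z)) _)
    (g := fun z => T (tassoc (z ⊗ y)))) (D a) => [||b c].
  - by move=> c z1 z2; rewrite tmap_lin tfold_lin mlinl.
  - by move=> c z1 z2; rewrite otimes_linl tassoc_lin T_lin.
  by rewrite tassoc_otimes T_otimes !tfold_tmap // mA.
rewrite tassocE !tmapE (coalg_coassoc (bialg_coalgebra bialg)) -tmapE.
apply: (lin_eq_otimes (f := fun z => T (tmap (@id H) D z))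
  (g := fun z => tfold m (tmap f (convol g h) z))) (D x) => [||a y].
- by move=> c y z; rewrite tmap_lin T_lin.
- by move=> c y z; rewrite tmap_lin tfold_lin.
rewrite (tmap_otimes (f := @id H) (g := D) _ _ id_lin D_lin).
by rewrite T_otimes tfold_tmap.
Qed.

Let ue x := u (e x).

Let uE c : u c = c *: u 1.
Proof.
have u_lin := alg_unit_linear (bialg_algebra bialg).
have u0 : u 0 = 0.
  by have := u_lin (-1) 0 0; rewrite mulr0 addr0 scaleN1r addNr.
by have := u_lin c 1 0; rewrite mulr1 !addr0 u0 addr0.
Qed.

Let ue_lin : linear ue.
Proof. by move=> c x y; rewrite /ue !(uE (e _)) e_lin scalerDl scalerA. Qed.

Let convol_uel f : linear f -> convol ue f = f.
Proof.
move=> lf; apply/funext => x.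
rewrite -[RHS](congr1 f (coalg_counitl (bialg_coalgebra bialg) x)) -tcounitlE.
apply: (lin_eq_otimes (f := fun z => tfold m (tmap ue f z))
  (g := fun z => f (tcounitl e z))) (D x) => [||a y].
- by move=> c y z; rewrite tmap_lin tfold_lin.
- by move=> c y z; rewrite tcounitl_lin lf.
rewrite tfold_tmap // tcounitl_otimes // (linZ lf) /ue uE (linZ (mlinl _)).
by rewrite (alg_mul1l (bialg_algebra bialg)).
Qed.

Let convol_uer f : linear f -> convol f ue = f.
Proof.
move=> lf; apply/funext => x.
rewrite -[RHS](congr1 f (coalg_counitr (bialg_coalgebra bialg) x)) -tcounitrE.
apply: (lin_eq_otimes (f := fun z => tfold m (tmap f ue z))
  (g := fun z => f (tcounitr e z))) (D x) => [||a y].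
- by move=> c y z; rewrite tmap_lin tfold_lin.
- by move=> c y z; rewrite tcounitr_lin lf.
rewrite tfold_tmap // tcounitr_otimes // (linZ lf) /ue uE (linZ (mlinr _)).
by rewrite (alg_mulr1 (bialg_algebra bialg)).
Qed.

Let convol_combl c f f' g x : linear f -> linear f' -> linear g ->
  convol (fun x => c *: f x + f' x) g x = c *: convol f g x + convol f' g x.
Proof.
move=> lf lf' lg.
have lc : linear (fun x => c *: f x + f' x).
  by move=> d y z; rewrite lf lf' !scalerDr !scalerA addrACA mulrC.
apply: (lin_eq_otimes (f := fun z => tfold m (tmap (fun x => c *: f x + f' x) g z))
  (g := fun z => c *: tfold m (tmap f g z) + tfold m (tmap f' g z))) (D x) => [||a y].
- by move=> d y z; rewrite tmap_lin tfold_lin.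
- by move=> d y z; rewrite !tmap_lin !tfold_lin !scalerDr !scalerA addrACA mulrC.
by rewrite !tfold_tmap // mlinl.
Qed.

Let convol_combr c f g g' x : linear f -> linear g -> linear g' ->
  convol f (fun x => c *: g x + g' x) x = c *: convol f g x + convol f g' x.
Proof.
move=> lf lg lg'.
have lc : linear (fun x => c *: g x + g' x).
  by move=> d y z; rewrite lg lg' !scalerDr !scalerA addrACA mulrC.
apply: (lin_eq_otimes (f := fun z => tfold m (tmap f (fun x => c *: g x + g' x) z))
  (g := fun z => c *: tfold m (tmap f g z) + tfold m (tmap f g' z))) (D x) => [||a y].
- by move=> d y z; rewrite tmap_lin tfold_lin.
- by move=> d y z; rewrite !tmap_lin !tfold_lin !scalerDr !scalerA addrACA mulrC.
by rewrite !tfold_tmap // mlinr.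
Qed.

Let pi x := x - ue x.
Let pi_lin : linear pi. Proof. exact: lin_sub. Qed.

Let pw n : H -> H := iter n (convol pi) ue.
Let pw_lin n : linear (pw n).
Proof. by case: n => [|n]; [exact: ue_lin|exact: convol_lin]. Qed.

Let pwSr n : convol (pw n) pi = pw n.+1.
Proof.
elim: n => [|n IH]; first by rewrite /= convol_uel // convol_uer.
by rewrite /= convolA // -/(pw n) IH.
Qed.

Let id_pi : @id H = (fun x => 1 *: pi x + ue x).
Proof. by apply/funext => x; rewrite scale1r subrK. Qed.

Let convol_pw_id n x : convol (pw n) id x = pw n.+1 x + pw n x.
Proof. by rewrite id_pi convol_combr // scale1r pwSr convol_uer. Qed.

Let convol_id_pw n x : convol id (pw n) x = pw n.+1 x + pw n x.
Proof. by rewrite id_pi convol_combl // scale1r convol_uel. Qed.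

(** In the coproduct of an element of degree [d], the left components of degree
    0 lie in the image of the unit, hence are killed by [pi]; the others leave
    a right component of degree below [d], to which induction applies. *)
Let pw_graded n d x : G d x -> (d < n)%N -> pw n x = 0.
Proof.
elim: n => [//|n IH] in d x *; move=> Gx lt_d.
have [t [tG DxE]] := graded_Delta (connected_graded cb) Gx.
rewrite /= /convol DxE (lin_sum (tmap_lin _ _)) (lin_sum (tfold_lin _)).
apply: big1 => -[p lt_p] _ /=.
have [s [sG ->]] := tG p lt_p.
rewrite (lin_sum (tmap_lin _ _)) (lin_sum (tfold_lin _)).
rewrite big_seq; apply: big1 => -[y z] /sG[/= Gy Gz].
rewrite -otimesE tfold_tmap // -/(pw n).
case: p lt_p Gy Gz {tG sG} => [|p] lt_p Gy Gz.
  move: Gy; rewrite (connected_0 cb) => -[c _ <-].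
  have eu : e (u c) = c.
    rewrite uE; have := e_lin c (u 1) 0; rewrite addr0 (bialg_eps1 bialg) mulr1 => ->.
    have : e 0 = 0.
      by have := e_lin (-1) 0 0; rewrite scaler0 addr0 mulN1r addNr.
    by move=> ->; rewrite addr0.
  by rewrite /pi /ue eu subrr (lin0 (mlinl _)).
by rewrite (IH _ _ Gz) ?(lin0 (mlinr _)) //; lia.
Qed.

Let pw_nil x : exists N, forall n, (N <= n)%N -> pw n x = 0.
Proof.
have [N [h [hG ->]]] := dsum_span (graded_dsum (connected_graded cb)) x.
exists N => n le_n; rewrite (lin_sum (pw_lin n)); apply: big1 => i _.
by apply: pw_graded (hG i) _; apply: leq_trans le_n.
Qed.

(** A choice of truncation index for each element; any larger one gives the
    same value of the antipode by [S_geom], which is why [S] is linear. *)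
Let N x := projT1 (cid (pw_nil x)).
Let pwN x n : (N x <= n)%N -> pw n x = 0.
Proof. exact: (projT2 (cid (pw_nil x))). Qed.

(** The n-th partial sum of the geometric series that inverts
    id = u eps + pi under convolution. *)
Let Fixpoint geom n (x : H) : H :=
  if n is n'.+1 then (-1) ^+ n' *: pw n' x + geom n' x else 0.

Let geom_lin n : linear (geom n).
Proof.
elim: n => [|n IH] c x y /=; first by rewrite scaler0 addr0.
by rewrite IH pw_lin !scalerDr !scalerA addrACA mulrC.
Qed.

Let S x := geom (N x) x.
Let S_geom x n : (N x <= n)%N -> S x = geom n x.
Proof.
elim: n => [|n IH]; first by rewrite leqn0 /S => /eqP ->.
rewrite leq_eqVlt => /orP[/eqP eqn|le_n]; first by rewrite /S eqn.
by rewrite /= pwN // scaler0 add0r; apply: IH.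
Qed.

Let S_lin : linear S.
Proof.
move=> c x y; pose n := maxn (N (c *: x + y)) (maxn (N x) (N y)).
by rewrite !(@S_geom _ n) ?geom_lin // /n ?leq_maxl // leq_max leq_max ?leqnn ?orbT.
Qed.

(** The zero map in the shape to which [convol_combl] and [convol_combr]
    apply. *)
Let geom0 : geom 0 = (fun x => (-1) *: ue x + ue x).
Proof. by apply/funext => y; rewrite scaleN1r addNr. Qed.

Let telescope n (x y z : H) :
  (-1) ^+ n *: (y + x) + (z - (-1) ^+ n *: x) = z - (-1) ^+ n.+1 *: y.
Proof.
by rewrite exprS mulN1r scaleNr opprK scalerDr -addrA [X in _ + X]addrC subrK addrC.
Qed.

Let geom_convoll n x : convol (geom n) id x = ue x - (-1) ^+ n *: pw n x.
Proof.
elim: n x => [|n IH] x.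
  by rewrite expr0 scale1r subrr geom0 convol_combl // scaleN1r addNr.
by rewrite /= convol_combl // IH convol_pw_id telescope.
Qed.

Let geom_convolr n x : convol id (geom n) x = ue x - (-1) ^+ n *: pw n x.
Proof.
elim: n x => [|n IH] x.
  by rewrite expr0 scale1r subrr geom0 convol_combr // scaleN1r addNr.
by rewrite /= convol_combr // IH convol_id_pw telescope.
Qed.

(** The coproduct of [x] has finitely many terms, so one truncation index
    serves for [x] and for all their components. *)
Let S_convol x : exists n, [/\ pw n x = 0, convol S id x = convol (geom n) id x
  & convol id S x = convol id (geom n) x].
Proof.
pose F (p : B * B) := maxn (N (basis p.1)) (N (basis p.2)).
pose n := maxn (N x) (\max_(p <- msupp (D x)) F p).
have le1 p : p \in msupp (D x) -> (N (basis p.1) <= n)%N.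
  move=> xp; rewrite leq_max; apply/orP; right.
  apply: leq_trans (@leq_bigmax_seq _ _ predT F _ xp isT).
  exact: leq_maxl.
have le2 p : p \in msupp (D x) -> (N (basis p.2) <= n)%N.
  move=> xp; rewrite leq_max; apply/orP; right.
  apply: leq_trans (@leq_bigmax_seq _ _ predT F _ xp isT).
  exact: leq_maxr.
exists n; split; first by apply: pwN; apply: leq_maxl.
  rewrite /convol; congr (tfold m _); rewrite [D x]freemodE !(lin_sum (tmap_lin _ _)).
  apply: eq_big_seq => -[a b] /le1 /= le_a; rewrite !(linZ (tmap_lin _ _)).
  by rewrite -otimes_basis !tmap_otimes // (S_geom le_a).
rewrite /convol; congr (tfold m _); rewrite [D x]freemodE !(lin_sum (tmap_lin _ _)).
apply: eq_big_seq => -[a b] /le2 /= le_b; rewrite !(linZ (tmap_lin _ _)).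
by rewrite -otimes_basis !tmap_otimes // (S_geom le_b).
Qed.

(** Convolving a partial sum with the identity telescopes to [ue] up to a power
    of [pi], which vanishes on [x] for a large enough index. *)
Lemma connected_bialgebra_hopf : is_hopf_algebra m u D e.
Proof.
split=> //; exists S; split=> [|x|x]; first exact: S_lin.
  rewrite -convolE; have [n [n0 -> _]] := S_convol x.
  by rewrite geom_convoll n0 scaler0 subr0.
rewrite -convolE; have [n [n0 _ ->]] := S_convol x.
by rewrite geom_convolr n0 scaler0 subr0.
Qed.
End Antipode.

(** * The free Rota-Baxter algebra *)
Section Final.
Context (k : comPzRingType) (X : Type).
Local Notation H := (freemod k (rbw X)).
Local Notation one := (@wmon k X [::]).

Lemma unitH1 : @unitH k X 1 = one.
Proof. by rewrite wmon1E /unitH scale1r. Qed.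

Lemma rb_bialgebra : is_bialgebra (@diamond k X) (@unitH k X) (@Delta k X) (@eps k X).
Proof.
rewrite -rbmulE -rbDeltaE; split.
- split.
  + exact: rbmul_bilin.
  + exact: rbmulA.
  + by move=> a b c; rewrite /unitH scalerDl scalerA.
  + by move=> x; rewrite unitH1; apply: rbmul_w1l.
  + by move=> x; rewrite unitH1; apply: rbmul_w1r.
- split.
  + exact: rbDelta_lin.
  + exact: eps_lin.
  + by move=> x; rewrite -tassocE -!tmapE; apply: rbDelta_coassoc.
  + by move=> x; rewrite -tcounitlE; apply: rbDelta_counitl.
  + by move=> x; rewrite -tcounitrE; apply: rbDelta_counitr.
- by rewrite unitH1 -otimesE; apply: rbDelta1.
- by move=> x y; rewrite -tmulE; apply: rbDeltaM.
- by rewrite unitH1 eps_wmon.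
- by move=> x y; apply: epsM.
Qed.

Lemma Hdeg0E : @Hdeg k X 0 = range (@unitH k X).
Proof.
apply/seteqP; split=> [x hx|_ [a _ <-]].
  exists x@_rbw1 => //; rewrite /unitH.
  apply/malgP => w; rewrite fcoeffZ mcoeffU.
  have [<-|w1] := eqVneq rbw1 w; first by rewrite mulr1.
  rewrite mulr0; apply/esym/mcoeff_outdom; apply: contra w1 => /hx dw.
  by apply/eqP/val_inj; rewrite (wdeg_eq0 dw).
rewrite /unitH; apply: (homogZ (d := @deg X)).
exact: (@homog_basis k _ (@deg X) rbw1).
Qed.

Lemma rb_connected_bialgebra :
  is_connected_bialgebra (@diamond k X) (@unitH k X) (@Delta k X) (@eps k X)
    (@Hdeg k X).
Proof.
split; last exact: Hdeg0E.
- split; first exact: rb_bialgebra.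
  + exact: homog_direct_sum.
  + by rewrite -rbmulE => p q x y; apply: Hdeg_rbmul.
  + move=> n x hx; rewrite -rbDeltaE; apply: homog_tens_sub.
    exact: homog_rbDelta.
- have epsK c : eps (@unitH k X c) = c.
    by apply: etrans (fcoeffZ c (basis rbw1) rbw1) _; rewrite mcoeffUU mulr1.
  exact: can_inj epsK.
Qed.

End Final.

Theorem theorem4p1 (k : comPzRingType) (X : Type) :
  is_connected_bialgebra (@diamond k X) (@unitH k X) (@Delta k X) (@eps k X)
    (@Hdeg k X) /\
  is_hopf_algebra (@diamond k X) (@unitH k X) (@Delta k X) (@eps k X).
Proof.
have cb := rb_connected_bialgebra k X.
by split; [exact: cb|exact: connected_bialgebra_hopf cb].
Qed.
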